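(* Let $(f_n)_{n\in\mathbb{N}}$ be a Cauchy sequence in $\mathcal{C}_0$ with respect to the norm $\|\cdot\|_{M^{\infty,1}_{(g)}(\mathbb{R}^\infty)}$, and let $f$ be its equivalence class. Then for all $k\in\mathbb{N}$ the sequence $(f_n^{(k)})_{n\in\mathbb{N}}$ of restrictions $$f_n^{(k)}(x_1,\dots,x_k)=f_n(x_1,\dots,x_k,0,0,\dots)$$ is Cauchy in $M^{\infty,1}(\mathbb{R}^k)$. Its limit, denoted by $f^{(k)}$, does not depend on the representative $(f_n)_n$ of the equivalence class $f$.
   Context: Fix $\hbar\in(0,1]$. For $g\in\mathcal{S}(\mathbb{R}^n)$ and $h\in\mathcal{S}'(\mathbb{R}^n)$, $V_gh(x,\xi)$ is the Fourier transform of $h\,\overline{g(\cdot-x)}$ at $\xi$, normalized as $V_gh(x,\xi)=(2\pi\hbar)^{-n/2}\int e^{-\frac i\hbar\xi\cdot y}h(y)\overline{g(y-x)}\,dy$. $\|h\|_{M^{\infty,1}_{(g)}(\mathbb{R}^n)}=\int_{\mathbb{R}^n}\sup_{x}|V_gh(x,\xi)|\,d\xi$; $M^{\infty,1}(\mathbb{R}^n)$ is the Banach space of $h\in\mathcal{S}'(\mathbb{R}^n)$ with finite norm (different nonzero Schwartz windows give equivalent norms); its elements are bounded continuous functions. Fix a sequence $(q_j)_{j\in\mathbb{N}}$ of positive reals with $\sum_jq_j^2<\infty$ and let $g_n(x)=(2\pi\hbar)^{-n/2}e^{-\frac1{2\hbar}\sum_{j=1}^nq_jx_j^2}$, $x\in\mathbb{R}^n$.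 $\mathbb{R}^\infty=\mathbb{R}^{\mathbb{N}}$ is the space of real sequences and $\pi_n:\mathbb{R}^\infty\to\mathbb{R}^n$ is the projection on the first $n$ coordinates. For $h:\mathbb{R}^n\to\mathbb{C}$ let $\mathcal{E}_nh:\mathbb{R}^\infty\to\mathbb{C}$, $\mathcal{E}_nh(x)=h(\pi_nx)$. The set of cylinder functions is $\mathcal{C}_0=\bigcup_n\mathcal{E}_nM^{\infty,1}(\mathbb{R}^n)$, with norm $\|\mathcal{E}_nh\|_{M^{\infty,1}_{(g)}(\mathbb{R}^\infty)}:=\|h\|_{M^{\infty,1}_{(g_n)}(\mathbb{R}^n)}$ for $h\in M^{\infty,1}(\mathbb{R}^n)$ (independent of the representation). Two Cauchy sequences $(f_n)$, $(f_n')$ in $\mathcal{C}_0$ are equivalent if $\|f_n-f_n'\|_{M^{\infty,1}_{(g)}(\mathbb{R}^\infty)}\to0$; $D(L)=\overline{\mathcal{C}_0}$ denotes the set of equivalence classes (the completion). *)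

(* Defs.v *)
From HB Require Import structures.
From mathcomp Require Import all_boot all_order all_algebra.
From mathcomp Require Import complex.
From mathcomp Require Import all_classical all_reals all_analysis.

Set Implicit Arguments.
Unset Strict Implicit.
Unset Printing Implicit Defensive.

Import Order.TTheory GRing.Theory Num.Theory.
Import numFieldNormedType.Exports.

Local Open Scope classical_set_scope.
Local Open Scope ring_scope.
Local Open Scope complex_scope.

Definition rV_display : measure_display.
Proof. exact: default_measure_display. Qed.

(* 'rV[R]_n carries the product sigma-algebra, generated by the coordinates. *)
Section rV_measurable.
Context (R : realType) (n : nat).

Definition rV_coord (i : 'I_n) (x : 'rV[R]_n) : measurableTypeR R := x 0 i.

Let rV_set0 : g_sigma_preimage rV_coord set0.
Proof. exact: sigma_algebra0. Qed.

Let rV_setC A : g_sigma_preimage rV_coord A -> g_sigma_preimage rV_coord (~` A).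
Proof. exact: sigma_algebraC. Qed.

Let rV_bigcup (F : _^nat) : (forall i, g_sigma_preimage rV_coord (F i)) ->
  g_sigma_preimage rV_coord (\bigcup_i (F i)).
Proof. exact: sigma_algebra_bigcup. Qed.

HB.instance Definition _ := @isMeasurable.Build rV_display
  'rV[R]_n (g_sigma_preimage rV_coord) rV_set0 rV_setC rV_bigcup.

Lemma measurable_rV_coord (i : 'I_n) :
  measurable_fun [set: 'rV[R]_n] (rV_coord i).
Proof.
move=> _ Y mY; rewrite setTI; apply: sub_sigma_algebra => /=.
rewrite -bigcup_seq/=; exists i => /=; first by rewrite mem_index_enum.
by exists Y => //; rewrite setTI.
Qed.

End rV_measurable.

Lemma measurable_fun_rV (R : realType) n d (T : measurableType d)
    (f : T -> 'rV[R]_n) :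
  (forall i, measurable_fun setT (@rV_coord R n i \o f)) ->
  measurable_fun setT f.
Proof.
move=> coord _ A mA; rewrite setTI.
have : preimage_set_system setT f
    (g_sigma_preimage (@rV_coord R n)) (f @^-1` A).
  by exists A => //; rewrite setTI.
rewrite -g_sigma_preimage_comp; apply.
split; first exact: sigma_algebra_measurable.
rewrite -bigcup_seq; apply: bigcup_sub => i _ B [C mC <-].
exact: coord.
Qed.

Section lebesgue_rV.
Context (R : realType).

Definition cons_rV n (p : measurableTypeR R * 'rV[R]_n) : 'rV[R]_n.+1 :=
  \row_i oapp (p.2 0) p.1 (unlift ord0 i).

Lemma measurable_cons_rV n : measurable_fun setT (@cons_rV n).
Proof.
apply: measurable_fun_rV => i; rewrite /comp /rV_coord /cons_rV.
case: (unliftP ord0 i) => [j ->|->].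
  apply: (eq_measurable_fun (@rV_coord R n j \o snd)).
    by move=> p _; rewrite /= mxE liftK.
  by apply: measurableT_comp => //; exact: measurable_rV_coord.
apply: (eq_measurable_fun fst) => //.
by move=> p _; rewrite /= mxE unlift_none.
Qed.

Definition uncons_rV n (x : 'rV[R]_n.+1) : measurableTypeR R * 'rV[R]_n :=
  (x 0 ord0, \row_j x 0 (lift ord0 j)).

Lemma measurable_uncons_rV n : measurable_fun setT (@uncons_rV n).
Proof.
apply: measurable_fun_pair => /=; first exact: (@measurable_rV_coord R _ ord0).
apply: measurable_fun_rV => j.
apply: (eq_measurable_fun (@rV_coord R n.+1 (lift ord0 j))).
  by move=> x _; rewrite /rV_coord /= mxE.
exact: measurable_rV_coord.
Qed.

Lemma cons_rVK n : cancel (@cons_rV n) (@uncons_rV n).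
Proof.
case=> a x; rewrite /uncons_rV /cons_rV; congr (_, _).
  by rewrite mxE unlift_none.
by apply/rowP => j; rewrite !mxE liftK.
Qed.

Lemma uncons_rVK n : cancel (@uncons_rV n) (@cons_rV n).
Proof.
move=> x; apply/rowP => i; rewrite mxE /uncons_rV /=.
by case: unliftP => [j ->|->] /=; rewrite ?mxE.
Qed.

Section lebesgue_cons.
Context (n : nat) (mu : {sigma_finite_measure set 'rV[R]_n -> \bar R}).

Definition lebesgue_cons (A : set 'rV[R]_n.+1) : \bar R :=
  pushforward (lebesgue_measure \x mu)%E (@cons_rV n) A.

Let lebesgue_cons0 : lebesgue_cons set0 = 0%E.
Proof. by rewrite /lebesgue_cons /pushforward preimage_set0 measure0. Qed.

Let lebesgue_cons_ge0 A : (0 <= lebesgue_cons A)%E.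
Proof. by rewrite /lebesgue_cons /pushforward; apply: measure_ge0. Qed.

Let lebesgue_cons_sigma_additive : semi_sigma_additive lebesgue_cons.
Proof.
exact: (@measure_semi_sigma_additive _ _ _
  (measure_function_pushforward__canonical__measure_function_Measure
    (lebesgue_measure \x mu)%E (@measurable_cons_rV n))).
Qed.

HB.instance Definition _ := isMeasure.Build _ _ _ lebesgue_cons
  lebesgue_cons0 lebesgue_cons_ge0 lebesgue_cons_sigma_additive.

Let lebesgue_cons_sigma_finite : sigma_finite setT lebesgue_cons.
Proof.
have /sigma_finiteP[F [TF ndF Foo]] := sigma_finiteT (@lebesgue_measure R).
have /sigma_finiteP[G [TG ndG Goo]] := sigma_finiteT mu.
exists (fun i => @uncons_rV n @^-1` (F i `*` G i)).
  rewrite -preimage_bigcup -(preimage_setT (@uncons_rV n)); congr (_ @^-1` _).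
  apply/esym/seteqP; split=> // -[a x] _.
  have [i _ Fi] : (\bigcup_i F i) a by rewrite -TF.
  have [j _ Gj] : (\bigcup_i G i) x by rewrite -TG.
  exists (maxn i j) => //; split => /=.
    by move: a Fi; exact/subsetPset/ndF/leq_maxl.
  by move: x Gj; exact/subsetPset/ndG/leq_maxr.
move=> i; have [mF Fi] := Foo i; have [mG Gi] := Goo i; split.
  rewrite -[X in measurable X]setTI; apply: measurable_uncons_rV => //.
  exact: measurableX.
rewrite /lebesgue_cons /pushforward -comp_preimage.
rewrite (_ : _ \o _ = id); last by rewrite funeqE => p; exact: cons_rVK.
by rewrite preimage_id product_measure1E// lte_mul_pinfty// ge0_fin_numE.
Qed.

HB.instance Definition _ := Measure_isSigmaFinite.Build _ _ _ lebesgue_cons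
  lebesgue_cons_sigma_finite.
End lebesgue_cons.

(* n-dimensional Lebesgue measure: the Dirac mass on R^0, then the image of
   lebesgue_measure \x lebesgue_rV n under (t, x) |-> (t, x_0, .., x_(n-1)). *)
Fixpoint lebesgue_rV n : {sigma_finite_measure set 'rV[R]_n -> \bar R} :=
  match n with
  | 0 => \d_(0 : 'rV[R]_0)
  | m.+1 => lebesgue_cons (lebesgue_rV m)
  end.

Lemma lebesgue_rV_box n (A : 'I_n -> set (measurableTypeR R)) :
  (forall i, measurable (A i)) ->
  lebesgue_rV n [set x : 'rV[R]_n | forall i, A i (x 0 i)] =
  (\prod_(i < n) lebesgue_measure (A i))%E.
Proof.
elim: n A => [|n IH] A mA.
  rewrite big_ord0 /= diracE mem_set //.
  by move=> [].
rewrite big_ord_recl -IH; last by move=> i; exact: mA.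
set B := [set x : 'rV[R]_n | _]; have mB : measurable B.
  pose G i := @rV_coord R n i @^-1` A (lift ord0 i).
  rewrite (_ : B = \bigcap_(i in setT) G i); last first.
    by apply/seteqP; split=> x h i; [move=> _|]; exact: h.
  apply: fin_bigcap_measurable => // i _.
  rewrite -[X in measurable X]setTI.
  exact: measurable_rV_coord.
rewrite -product_measure1E //.
rewrite [LHS]/= /lebesgue_cons /pushforward; congr (_ _).
apply/seteqP; split => -[a x] /=.
  move=> h; split; first by have := h ord0; rewrite mxE unlift_none.
  by move=> i; have := h (lift ord0 i); rewrite mxE liftK.
move=> [h1 h2] i; rewrite mxE.
by case: unliftP => [j ->|->] /=.
Qed.

End lebesgue_rV.

Section complex_functions.
Context (R : realType).

Definition cexp_i (t : R) : R[i] := cos t +i* sin t.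

Definition cintegral n (f : 'rV[R]_n -> R[i]) : R[i] :=
  (\int[lebesgue_rV R n]_x complex.Re (f x))
  +i* (\int[lebesgue_rV R n]_x complex.Im (f x)).

Definition dot n (x y : 'rV[R]_n) : R := \sum_(i < n) x 0 i * y 0 i.

End complex_functions.

Section schwartz.
Context (R : realType) (n : nat).
Implicit Types (f phi : 'rV[R]_n -> R[i]) (s : seq 'I_n) (a : 'I_n -> nat).

Definition partial (i : 'I_n) f : 'rV[R]_n -> R[i] := fun x =>
  ('D_(delta_mx 0 i) (fun y => complex.Re (f y)) x)
  +i* ('D_(delta_mx 0 i) (fun y => complex.Im (f y)) x).

Definition iter_partial s f : 'rV[R]_n -> R[i] := foldr partial f s.

Definition smooth f := forall s,
  continuous (iter_partial s f : 'rV[R]_n -> R[i]^o) /\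
  forall i x, derivable (fun y => complex.Re (iter_partial s f y)) x (delta_mx 0 i)
           /\ derivable (fun y => complex.Im (iter_partial s f y)) x (delta_mx 0 i).

Definition seminorm a s f : \bar R := ereal_sup
  [set (`|\prod_(i < n) x 0 i ^+ a i| * Normc.normc (iter_partial s f x))%:E
     | x in [set: 'rV[R]_n]].

Definition schwartz f := smooth f /\ forall a s, (seminorm a s f < +oo)%E.

(* A tempered distribution is a functional of which only the values on Schwartz
   functions matter. *)
Definition tempered (u : ('rV[R]_n -> R[i]) -> R[i]) :=
  (forall (c : R[i]) phi psi, schwartz phi -> schwartz psi ->
     u (fun x => c * phi x + psi x) = c * u phi + u psi) /\
  (forall (phi_ : nat -> 'rV[R]_n -> R[i]) phi,
     (forall j, schwartz (phi_ j)) -> schwartz phi ->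
     (forall a s, seminorm a s (fun x => phi_ j x - phi x)
                    @[j --> \oo] --> 0%E) ->
     (u (phi_ j) : R[i]^o) @[j --> \oo] --> (u phi : R[i]^o)).

Definition distribution_of (h : 'rV[R]_n -> R[i]) :
    ('rV[R]_n -> R[i]) -> R[i] :=
  fun phi => cintegral (fun y => h y * phi y).

End schwartz.

Section modulation_space.
Context (R : realType) (hbar : R) (n : nat).
Implicit Types (g : 'rV[R]_n -> R[i]) (u : ('rV[R]_n -> R[i]) -> R[i]).

Definition stft g u (x xi : 'rV[R]_n) : R[i] :=
  ((2 * pi * hbar) `^ (- (n%:R / 2)))%:C *
  u (fun y => cexp_i (- (dot xi y / hbar)) * conjc (g (y - x))).

Definition Minf1_norm g u : \bar R :=
  (\int[lebesgue_rV R n]_xi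
     ereal_sup [set (Normc.normc (stft g u x xi))%:E
                 | x in [set: 'rV[R]_n]])%E.

(* The space does not depend on the nonzero Schwartz window g, and different
   windows give equivalent norms. *)
Definition Minf1 g u := tempered u /\ (Minf1_norm g u < +oo)%E.

(* The elements of M^{oo,1}, viewed as bounded continuous functions: h stands
   for the distribution phi |-> \int h phi, for which stft is the usual integral
   formula. *)
Definition Minf1_fun g : set ('rV[R]_n -> R[i]) := [set h |
  [/\ continuous (h : 'rV[R]_n -> R[i]^o),
      exists M : R, forall x, Normc.normc (h x) <= M
    & Minf1 g (distribution_of h)]].

Definition Minf1_dist g (h h' : 'rV[R]_n -> R[i]) : \bar R :=
  Minf1_norm g (distribution_of (fun x => h x - h' x)).

Definition Minf1_cauchy g (h_ : nat -> 'rV[R]_n -> R[i]) :=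
  (forall j, Minf1_fun g (h_ j)) /\
  forall e : R, 0 < e -> exists N : nat, forall i j,
    (N <= i)%N -> (N <= j)%N -> (Minf1_dist g (h_ i) (h_ j) < e%:E)%E.

Definition Minf1_lim g (h_ : nat -> 'rV[R]_n -> R[i]) h :=
  [/\ forall j, Minf1_fun g (h_ j), Minf1_fun g h
    & Minf1_dist g (h_ j) h @[j --> \oo] --> 0%E].

End modulation_space.

Section cylinder_functions.
Context (R : realType) (hbar : R) (q : nat -> R).
Implicit Types F : (nat -> R) -> R[i].

(* The coordinates of R^n and of R^oo are numbered from 0. The windows below
   are gauss_window n on every M^{oo,1}(R^n). *)
Definition gauss_window n (x : 'rV[R]_n) : R[i] :=
  ((2 * pi * hbar) `^ (- (n%:R / 2)) *
   expR (- ((2 * hbar)^-1 * \sum_(j < n) q j * x 0 j ^+ 2)))%:C.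

Definition proj_rV n (x : nat -> R) : 'rV[R]_n := \row_(i < n) x i.

Definition cylinder n (h : 'rV[R]_n -> R[i]) : (nat -> R) -> R[i] :=
  fun x => h (proj_rV n x).

Definition C0 : set ((nat -> R) -> R[i]) := [set F |
  exists n, exists2 h, Minf1_fun hbar (@gauss_window n) h & F = cylinder h].

(* The value does not depend on the representation F = cylinder h; it is +oo
   (by convention) if F is not a cylinder function. *)
Definition C0_norm F : \bar R := xget +oo%E [set r |
  exists n, exists h : 'rV[R]_n -> R[i],
    [/\ Minf1_fun hbar (@gauss_window n) h, F = cylinder h
      & r = Minf1_norm hbar (@gauss_window n) (distribution_of h)]].

Definition C0_dist F F' : \bar R := C0_norm (fun x => F x - F' x).

Definition C0_cauchy (f_ : nat -> (nat -> R) -> R[i]) :=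
  (forall j, C0 (f_ j)) /\
  forall e : R, 0 < e -> exists N : nat, forall i j,
    (N <= i)%N -> (N <= j)%N -> (C0_dist (f_ i) (f_ j) < e%:E)%E.

Definition C0_equiv (f_ f'_ : nat -> (nat -> R) -> R[i]) :=
  C0_dist (f_ j) (f'_ j) @[j --> \oo] --> 0%E.

Definition C0_class (f_ : nat -> (nat -> R) -> R[i]) :
    set (nat -> (nat -> R) -> R[i]) :=
  [set f'_ | C0_cauchy f'_ /\ C0_equiv f_ f'_].

Definition extend0 k (x : 'rV[R]_k) : nat -> R :=
  fun i => if insub i is Some j then x 0 j else 0.

Definition restriction k F : 'rV[R]_k -> R[i] := fun x => F (extend0 x).

End cylinder_functions.

(* Main.v *)
Require Import Defs.
From HB Require Import structures.
From mathcomp Require Import all_boot all_order all_algebra.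
From mathcomp Require Import complex.
From mathcomp Require Import all_classical all_reals all_analysis.
From mathcomp Require Import measurable_realfun.
From mathcomp Require Import ring lra.

Set Implicit Arguments.
Unset Strict Implicit.
Unset Printing Implicit Defensive.

Import Order.TTheory GRing.Theory Num.Theory.
Import numFieldNormedType.Exports.

Local Open Scope classical_set_scope.
Local Open Scope ring_scope.
Local Open Scope complex_scope.

(* Put y = (x, t) with t the last coordinate, and let h be bounded continuous on
   R^(n+1). With the normalization g_n(0) = (2 pi hbar)^(-n/2), Fourier inversion
   in t at the point t = a gives
     V_(g_n) (h(., a)) (x, xi) =
       \int e^(i eta a / hbar) V_(g_(n+1)) h ((x, a), (xi, eta)) d eta,
   so freezing the last coordinate does not increase the norm; freezing all of
   them gives |h(x)| <= ||h||. Conversely, making h depend trivially on one more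
   coordinate multiplies |V h| by a Gaussian in eta of total mass 1. Hence
   restriction to R^k is a contraction from C_0 to M^(oo,1)(R^k), whatever the
   number of variables. By the sup bound, Cauchy sequences of M^(oo,1)(R^k)
   converge uniformly, and Fatou's lemma turns the uniform limit into a limit in
   norm. Since norm limits are pointwise limits, they are unique and do not
   depend on the representative. *)

(** * Lebesgue measure on R^(n+1) with the last coordinate split off *)

Section snoc.
Context (R : realType).

(** The inversion formula is proved as an inequality whose right-hand side may be infinite. It
    therefore applies to every bounded continuous function, in particular to every intermediate
    restriction, before its norm is known to be finite. Its constant must be exactly 1: any larger
    factor per coordinate would be raised to a power growing with the number of variables, and the
    elements of a sequence in C_0 need not share a number of variables. The value 1 comes out
    because (2 pi hbar)^(-n/2) normalizes both the transform and the window. The last coordinate is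
    the one split off, since the window of R^(n+1) gives it the new parameter q_n and restrictions
    drop the last coordinates; Lebesgue measure, however, is built by adding a first coordinate, and
    the two splittings have to be reconciled. Two further obstacles: the supremum over uncountably
    many x must be measurable in xi, which follows from lower semicontinuity, and membership in
    M^(oo,1) includes temperedness, which is derived from boundedness. *)

Definition snoc_rV n (p : 'rV[R]_n * measurableTypeR R) : 'rV[R]_n.+1 :=
  \row_i oapp (p.1 0) p.2 (unlift ord_max i).

Definition init_rV n (x : 'rV[R]_n.+1) : 'rV[R]_n := \row_j x 0 (lift ord_max j).

Lemma measurable_snoc_rV n : measurable_fun setT (@snoc_rV n).
Proof.
apply: measurable_fun_rV => i; rewrite /comp /rV_coord /snoc_rV.
case: (unliftP ord_max i) => [j ->|->].
  apply: (eq_measurable_fun (@rV_coord R n j \o fst)).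
    by move=> p _; rewrite /= mxE liftK.
  by apply: measurableT_comp => //; exact: measurable_rV_coord.
apply: (eq_measurable_fun snd) => //.
by move=> p _; rewrite /= mxE unlift_none.
Qed.

Lemma widen_ord_lift_max n (i : 'I_n) : widen_ord (leqnSn n) i = lift ord_max i.
Proof. by apply/val_inj; rewrite /= /bump leqNgt ltn_ord add0n. Qed.

Lemma snoc_rV_lift n (x : 'rV[R]_n) t j : snoc_rV (x, t) 0 (lift ord_max j) = x 0 j.
Proof. by rewrite mxE liftK. Qed.

Lemma snoc_rV_max n (x : 'rV[R]_n) t : snoc_rV (x, t) 0 ord_max = t.
Proof. by rewrite mxE unlift_none. Qed.

Lemma init_snoc n (x : 'rV[R]_n) t : init_rV (snoc_rV (x, t)) = x.
Proof. by apply/rowP => j; rewrite mxE snoc_rV_lift. Qed.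

Lemma snoc_init n (x : 'rV[R]_n.+1) : snoc_rV (init_rV x, x 0 ord_max) = x.
Proof.
apply/rowP => i; case: (unliftP ord_max i) => [j ->|->].
  by rewrite snoc_rV_lift mxE.
by rewrite snoc_rV_max.
Qed.

Lemma cons_snoc n t (x : 'rV[R]_n) (s : R) :
  cons_rV (t, snoc_rV (x, s)) = snoc_rV (cons_rV (t, x), s).
Proof.
apply/rowP => i; case: (unliftP ord0 i) => [j ->|->].
  rewrite mxE liftK /=; case: (unliftP ord_max j) => [k ->|->].
    have -> : lift ord0 (lift ord_max k) = lift ord_max (lift ord0 k).
      by apply/val_inj; rewrite /= /bump /= !add1n ltnS addnS.
    by rewrite !snoc_rV_lift mxE liftK.
  have -> : lift ord0 ord_max = ord_max :> 'I_n.+2 by apply/val_inj.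
  by rewrite !snoc_rV_max.
rewrite mxE unlift_none /=.
have -> : ord0 = lift ord_max ord0 :> 'I_n.+2 by apply/val_inj.
by rewrite snoc_rV_lift mxE unlift_none.
Qed.

Local Open Scope ereal_scope.

Lemma ge0_integral_cons n (f : 'rV[R]_n.+1 -> \bar R) :
  measurable_fun setT f -> (forall x, 0 <= f x) ->
  \int[lebesgue_rV R n.+1]_x f x =
  \int[lebesgue_measure]_t \int[lebesgue_rV R n]_x f (cons_rV (t, x)).
Proof.
move=> mf f0.
rewrite -(fubini_tonelli1 (f \o @cons_rV R n)); last 2 first.
  by apply: measurableT_comp => //; exact: measurable_cons_rV.
  by move=> x; exact: f0.
rewrite -[setT in RHS](preimage_setT (@cons_rV R n)).
rewrite -ge0_integral_pushforward //; first last.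
  exact: measurable_cons_rV.
Qed.

Lemma measurable_cons_snd n t : measurable_fun setT (fun x : 'rV[R]_n => cons_rV (t, x)).
Proof.
apply: (measurableT_comp (@measurable_cons_rV R n)).
exact: measurable_pair1.
Qed.

(** The measure grows at the front, but the splitting is at the end. Peel off the first coordinate,
    split the remaining vector at its end by the induction hypothesis, and reassemble with
    [cons_snoc]; in R^1 the first and last coordinates coincide. *)
Lemma ge0_integral_snoc_iter n (f : 'rV[R]_n.+1 -> \bar R) :
  measurable_fun setT f -> (forall x, 0 <= f x) ->
  \int[lebesgue_rV R n.+1]_x f x =
  \int[lebesgue_rV R n]_x \int[lebesgue_measure]_t f (snoc_rV (x, t)).
Proof.
elim: n f => [|n IH] f mf f0.
  rewrite ge0_integral_cons//= integral_dirac//=; last first.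
    apply: (@measurable_fun_fubini_tonelli_F _ _ _ _ _ lebesgue_measure (f \o @snoc_rV 0)) => //.
    by apply: (measurableT_comp mf); exact: measurable_snoc_rV.
  by move=> x; exact: f0.
  rewrite diracE mem_set// mul1e; apply: eq_integral => t _.
  rewrite integral_dirac//; last first.
    exact: (measurableT_comp mf (measurable_cons_snd _)).
  rewrite diracE mem_set// mul1e; congr f; apply/rowP => i; rewrite (ord1 i).
  rewrite !mxE (_ : ord_max = ord0) ?unlift_none //.
  by apply/val_inj.
have mG : measurable_fun [set: 'rV[R]_n.+1]
    (fun x => \int[lebesgue_measure]_s f (snoc_rV (x, s))).
  apply: (@measurable_fun_fubini_tonelli_F _ _ _ _ _ lebesgue_measure (f \o @snoc_rV n.+1)).
    by apply: (measurableT_comp mf); exact: measurable_snoc_rV.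
  by move=> x; exact: f0.
rewrite (ge0_integral_cons mf f0) (ge0_integral_cons mG); last first.
  by move=> x; apply: integral_ge0.
apply: eq_integral => t _; rewrite (IH (fun x => f (cons_rV (t, x)))); last 2 first.
  exact: (measurableT_comp mf (measurable_cons_snd _)).
  by move=> x; exact: f0.
apply: eq_integral => x _; apply: eq_integral => s _.
by rewrite cons_snoc.
Qed.

Lemma ge0_integral_snoc n (f : 'rV[R]_n.+1 -> \bar R) :
  measurable_fun setT f -> (forall x, 0 <= f x) ->
  \int[lebesgue_rV R n.+1]_x f x =
  \int[lebesgue_rV R n \x lebesgue_measure]_p f (snoc_rV p).
Proof.
move=> mf f0; rewrite ge0_integral_snoc_iter// fubini_tonelli1//.
by apply: (measurableT_comp mf); exact: measurable_snoc_rV.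
Qed.

(** The formula for nonnegative functions, tested on indicators, becomes an identity of measures.
    This is what carries it over to integrands of varying sign, through the change of variables for
    a pushforward. *)
Lemma lebesgue_rV_snoc n (A : set 'rV[R]_n.+1) : measurable A ->
  lebesgue_rV R n.+1 A =
  pushforward (lebesgue_rV R n \x lebesgue_measure) (@snoc_rV n) A.
Proof.
move=> mA.
have mA' : measurable (@snoc_rV n @^-1` A).
  by rewrite -[X in measurable X]setTI; exact: measurable_snoc_rV.
transitivity (\int[lebesgue_rV R n.+1]_x (\1_A x)%:E).
  by rewrite integral_indic// setIT.
rewrite ge0_integral_snoc; last 2 first.
  exact/measurable_EFinP/measurable_indic.
  by move=> x; rewrite lee_fin.
transitivity (\int[lebesgue_rV R n \x lebesgue_measure]_p
    (\1_(@snoc_rV n @^-1` A) p)%:E) => //.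
by rewrite integral_indic// setIT.
Qed.

Lemma integrable_snoc n (f : 'rV[R]_n.+1 -> \bar R) :
  measurable_fun setT f ->
  (lebesgue_rV R n \x lebesgue_measure).-integrable setT (f \o @snoc_rV n) ->
  (lebesgue_rV R n.+1).-integrable setT f.
Proof.
move=> mf /integrableP[mfs foo]; apply/integrableP; split => //.
by rewrite ge0_integral_snoc//; exact: measurableT_comp.
Qed.

Lemma integral_snoc n (f : 'rV[R]_n.+1 -> \bar R) :
  measurable_fun setT f ->
  (lebesgue_rV R n \x lebesgue_measure).-integrable setT (f \o @snoc_rV n) ->
  \int[lebesgue_rV R n.+1]_x f x =
  \int[lebesgue_rV R n \x lebesgue_measure]_p f (snoc_rV p).
Proof.
move=> mf foo.
have msn := @measurable_snoc_rV n.
rewrite -[RHS](integral_pushforward msn mf foo measurableT).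
apply: (eq_measure_integral
  (pushforward (lebesgue_rV R n \x lebesgue_measure) (@snoc_rV n))) => A mA _.
exact: lebesgue_rV_snoc.
Qed.


End snoc.

(** * Complex-valued integrals *)

Section complex_facts.
Context (R : realType).
Implicit Types z w : R[i].

Lemma normcE z : Normc.normc z = Num.sqrt (complex.Re z ^+ 2 + complex.Im z ^+ 2).
Proof. by case: z. Qed.

Lemma normc_ge0 z : 0 <= Normc.normc z.
Proof. by rewrite normcE sqrtr_ge0. Qed.

Lemma normc_sqr z : Normc.normc z ^+ 2 = complex.Re z ^+ 2 + complex.Im z ^+ 2.
Proof. by rewrite normcE sqr_sqrtr// addr_ge0// sqr_ge0. Qed.

Lemma ReM z w : complex.Re (z * w) =
  complex.Re z * complex.Re w - complex.Im z * complex.Im w.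
Proof. by case: z; case: w. Qed.

Lemma ImM z w : complex.Im (z * w) =
  complex.Re z * complex.Im w + complex.Im z * complex.Re w.
Proof. by case: z; case: w. Qed.

Lemma ReD z w : complex.Re (z + w) = complex.Re z + complex.Re w.
Proof. by case: z; case: w. Qed.

Lemma ImD z w : complex.Im (z + w) = complex.Im z + complex.Im w.
Proof. by case: z; case: w. Qed.

Lemma ReN z : complex.Re (- z) = - complex.Re z.
Proof. by case: z. Qed.

Lemma ImN z : complex.Im (- z) = - complex.Im z.
Proof. by case: z. Qed.

Lemma complex_eqP z w :
  complex.Re z = complex.Re w -> complex.Im z = complex.Im w -> z = w.
Proof. by case: z => a b; case: w => c d /= -> ->. Qed.

Lemma ler_normRe z : `|complex.Re z| <= Normc.normc z.
Proof.
by rewrite normcE -sqrtr_sqr ler_wsqrtr// lerDl sqr_ge0.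
Qed.

Lemma ler_normIm z : `|complex.Im z| <= Normc.normc z.
Proof.
by rewrite normcE -sqrtr_sqr ler_wsqrtr// lerDr sqr_ge0.
Qed.

Lemma normc_le_ReIm z : Normc.normc z <= `|complex.Re z| + `|complex.Im z|.
Proof.
rewrite -(@ler_pXn2r _ 2) ?nnegrE ?normc_ge0 ?addr_ge0//.
rewrite normc_sqr sqrrD !real_normK ?num_real//.
by rewrite -addrA lerD2l lerDr mulrn_wge0// mulr_ge0.
Qed.

Lemma normc_real (a : R) : Normc.normc a%:C = `|a|.
Proof. by rewrite normcE /= expr0n/= addr0 sqrtr_sqr. Qed.

Lemma normc_cexp (t : R) : Normc.normc (cexp_i t) = 1.
Proof. by rewrite normcE /= cos2Dsin2 sqrtr1. Qed.

Lemma cexpD (s t : R) : cexp_i (s + t) = cexp_i s * cexp_i t.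
Proof.
apply: complex_eqP; rewrite ?ReM ?ImM /= ?cosD ?sinD //.
by rewrite addrC [X in _ + X]mulrC [X in X + _]mulrC addrC mulrC [X in _ + X]mulrC.
Qed.

Lemma normcM z w : Normc.normc (z * w) = Normc.normc z * Normc.normc w.
Proof. exact: Normc.normcM. Qed.

Lemma normcD z w : Normc.normc (z + w) <= Normc.normc z + Normc.normc w.
Proof. exact: (@le_normcD R z w). Qed.

Lemma normc_opp z : Normc.normc (- z) = Normc.normc z.
Proof. exact: (@normcN R z). Qed.

Lemma normcB z w : Normc.normc (z - w) = Normc.normc (w - z).
Proof. by rewrite -normc_opp opprB. Qed.

Lemma normc_eq0 z : Normc.normc z = 0 -> z = 0.
Proof. exact: Normc.eq0_normc. Qed.

(** The witness is the conjugate of z divided by its modulus; at z = 0 the number 1 is taken. *)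
Lemma normc_rot z : exists2 w, Normc.normc w = 1 & complex.Re (w * z) = Normc.normc z.
Proof.
have [z0|z0] := eqVneq (Normc.normc z) 0.
  exists 1; first by rewrite (normc_real 1) normr1.
  by rewrite mul1r z0 (normc_eq0 z0).
have e := normc_sqr z; set N := Normc.normc z in z0 e *.
exists ((complex.Re z / N) +i* (- (complex.Im z / N))).
  rewrite normcE /= sqrrN !expr_div_n -mulrDl -e divff ?sqrtr1//.
  by rewrite sqrf_eq0.
rewrite ReM /=; apply: (mulfI z0); rewrite -expr2 e; field.
exact: z0.
Qed.

Lemma normc_leP z (r : R) :
  (forall w, Normc.normc w = 1 -> complex.Re (w * z) <= r) -> Normc.normc z <= r.
Proof. by move=> h; have [w w1 <-] := normc_rot z; exact: h. Qed.

End complex_facts.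

Section complex_measurable.
Context d (T : measurableType d) (R : realType).
Implicit Types f g : T -> R[i].

Definition Cmeasurable f :=
  measurable_fun [set: T] (fun x => complex.Re (f x)) /\
  measurable_fun [set: T] (fun x => complex.Im (f x)).

Lemma CmeasurableM f g : Cmeasurable f -> Cmeasurable g ->
  Cmeasurable (fun x => f x * g x).
Proof.
move=> [f1 f2] [g1 g2]; split.
  apply: (eq_measurable_fun _ (fun x _ => esym (ReM (f x) (g x)))).
  by apply: measurable_funB; exact: measurable_funM.
apply: (eq_measurable_fun _ (fun x _ => esym (ImM (f x) (g x)))).
by apply: measurable_funD; exact: measurable_funM.
Qed.

Lemma CmeasurableD f g : Cmeasurable f -> Cmeasurable g ->
  Cmeasurable (fun x => f x + g x).
Proof.
move=> [f1 f2] [g1 g2]; split.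
  apply: (eq_measurable_fun _ (fun x _ => esym (ReD (f x) (g x)))).
  exact: measurable_funD.
apply: (eq_measurable_fun _ (fun x _ => esym (ImD (f x) (g x)))).
exact: measurable_funD.
Qed.

Lemma Cmeasurable_cst (c : R[i]) : Cmeasurable (fun=> c).
Proof. by split; exact: measurable_cst. Qed.

Lemma Cmeasurable_real (f : T -> R) : measurable_fun setT f ->
  Cmeasurable (fun x => (f x)%:C).
Proof. by move=> mf; split => //=; exact: measurable_cst. Qed.

Lemma Cmeasurable_cexp (f : T -> R) : measurable_fun setT f ->
  Cmeasurable (fun x => cexp_i (f x)).
Proof.
move=> mf; split => /=.
  exact: (measurableT_comp (continuous_measurable_fun (@continuous_cos R))).
exact: (measurableT_comp (continuous_measurable_fun (@continuous_sin R))).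
Qed.

Lemma measurable_normc f : Cmeasurable f ->
  measurable_fun setT (fun x => Normc.normc (f x)).
Proof.
move=> [f1 f2].
apply: (eq_measurable_fun _ (fun x _ => esym (normcE (f x)))).
apply: (measurableT_comp (continuous_measurable_fun (@sqrt_continuous R))).
by apply: measurable_funD; exact: measurable_funX.
Qed.

End complex_measurable.

Lemma Cmeasurable_comp d d' (T : measurableType d) (T' : measurableType d')
    (R : realType) (phi : T' -> T) (f : T -> R[i]) :
  measurable_fun setT phi -> Cmeasurable f -> Cmeasurable (f \o phi).
Proof.
by move=> mphi [f1 f2]; split;
  [exact: (measurableT_comp f1)|exact: (measurableT_comp f2)].
Qed.

Section complex_integral.
Context d (T : measurableType d) (R : realType) (mu : {measure set T -> \bar R}).
Implicit Types f g : T -> R[i].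

(** [cintegral] for an arbitrary measure, convertible to it on [lebesgue_rV]; the line and product
    measures are needed as well. *)
Definition Cint f : R[i] :=
  (\int[mu]_x complex.Re (f x)) +i* (\int[mu]_x complex.Im (f x)).

Definition Cintegrable f :=
  mu.-integrable setT (fun x => (complex.Re (f x))%:E) /\
  mu.-integrable setT (fun x => (complex.Im (f x))%:E).

Lemma eq_Cint f g : f =1 g -> Cint f = Cint g.
Proof. by move=> /funext ->. Qed.

Lemma Cint_dominated f (G : T -> R) : Cmeasurable f ->
  mu.-integrable setT (EFin \o G) -> (forall x, Normc.normc (f x) <= G x) ->
  Cintegrable f.
Proof.
move=> [f1 f2] iG fG; split; apply: (le_integrable measurableT _ _ iG).
- exact/measurable_EFinP.
- move=> x _ /=; rewrite lee_fin; apply: (le_trans (ler_normRe _)).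
  exact: (le_trans (fG x) (ler_norm _)).
- exact/measurable_EFinP.
- move=> x _ /=; rewrite lee_fin; apply: (le_trans (ler_normIm _)).
  exact: (le_trans (fG x) (ler_norm _)).
Qed.

Lemma CintegrableZ (c : R[i]) f : Cintegrable f -> Cintegrable (fun x => c * f x).
Proof.
move=> [f1 f2]; split.
  rewrite (_ : (fun x => _) = (fun x => (complex.Re c)%:E * (complex.Re (f x))%:E)
    \- (fun x => (complex.Im c)%:E * (complex.Im (f x))%:E))%E.
    by apply: integrableB => //; exact: integrableZl.
  by apply/funext => x; rewrite ReM EFinB.
rewrite (_ : (fun x => _) = (fun x => (complex.Re c)%:E * (complex.Im (f x))%:E)
  \+ (fun x => (complex.Im c)%:E * (complex.Re (f x))%:E))%E.
  by apply: integrableD => //; exact: integrableZl.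
by apply/funext => x; rewrite ImM EFinD.
Qed.

Lemma integrable_mull (k : R) (f : T -> R) : mu.-integrable setT (EFin \o f) ->
  mu.-integrable setT (EFin \o (fun x => k * f x)).
Proof.
move=> h; rewrite (_ : _ \o _ = (fun x => k%:E * (EFin \o f) x))%E.
  exact: integrableZl.
by apply/funext => x /=; rewrite EFinM.
Qed.

Lemma CintD f g : Cintegrable f -> Cintegrable g ->
  Cint (fun x => f x + g x) = Cint f + Cint g.
Proof.
move=> [f1 f2] [g1 g2]; apply: complex_eqP; rewrite ?ReD ?ImD /=.
  by under eq_Rintegral do rewrite ReD; rewrite RintegralD.
by under eq_Rintegral do rewrite ImD; rewrite RintegralD.
Qed.

Lemma CintZ c f : Cintegrable f -> Cint (fun x => c * f x) = c * Cint f.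
Proof.
move=> [f1 f2]; apply: complex_eqP; rewrite ?ReM ?ImM /=.
  under eq_Rintegral do rewrite ReM.
  by rewrite RintegralB ?RintegralZl//; exact: integrable_mull.
under eq_Rintegral do rewrite ImM.
by rewrite RintegralD ?RintegralZl//; exact: integrable_mull.
Qed.

Lemma CintB f g : Cintegrable f -> Cintegrable g ->
  Cint (fun x => f x - g x) = Cint f - Cint g.
Proof.
move=> f1 g1.
transitivity (Cint (fun x => f x + (-1) * g x)).
  by apply: eq_Cint => x; rewrite mulN1r.
by rewrite CintD ?CintZ ?mulN1r//; exact: CintegrableZ.
Qed.

(** Estimating real and imaginary parts separately would lose a factor. Rotating the integral onto
    the real axis and moving the unit factor inside keeps the constant 1. *)
Lemma normc_Cint_le f (G : T -> R) : Cmeasurable f ->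
  mu.-integrable setT (EFin \o G) -> (forall x, Normc.normc (f x) <= G x) ->
  Normc.normc (Cint f) <= \int[mu]_x G x.
Proof.
move=> mf iG fG; have [f1 f2] := Cint_dominated mf iG fG.
apply: normc_leP => w w1; rewrite -CintZ//=.
apply: le_Rintegral => //.
  by have [] : Cintegrable (fun x => w * f x) by exact: CintegrableZ.
move=> x _; apply: (le_trans (ler_norm _)); apply: (le_trans (ler_normRe _)).
by rewrite normcM w1 mul1r.
Qed.

Lemma Rintegral_dct (f_ : nat -> T -> R) (f G : T -> R) :
  (forall j, measurable_fun setT (f_ j)) ->
  mu.-integrable setT (EFin \o G) -> (forall j x, `|f_ j x| <= G x) ->
  (forall x, f_ j x @[j --> \oo] --> f x) ->
  \int[mu]_x f_ j x @[j --> \oo] --> \int[mu]_x f x.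
Proof.
move=> mf iG fG cf.
have mlim : measurable_fun setT f.
  by apply: (measurable_fun_cvg (h := f_)) => // x _; exact: cf.
have fG' x : `|f x| <= G x.
  apply: (@cvgr_to_le _ \oo _ R (fun j => `|f_ j x|)); first by apply: cvg_norm; exact: cf.
  exact: nearW.
have ifin : (\int[mu]_x (f x)%:E)%E \is a fin_num.
  apply: integrable_fin_num => //; apply: (le_integrable measurableT _ _ iG).
    exact/measurable_EFinP.
  by move=> x _ /=; rewrite lee_fin (le_trans (fG' x))// ler_norm.
apply: fine_cvg; rewrite fineK//.
apply: (@dominated_cvg _ _ _ mu setT measurableT
  (fun j x => (f_ j x)%:E) (fun x => (f x)%:E) (EFin \o G)) => //.
- by move=> n; exact/measurable_EFinP.
- by move=> x _; apply: cvg_EFin; [exact: nearW|exact: cf].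
- by move=> n x _; rewrite /= lee_fin.
Qed.

(** The limit is phrased through moduli, the form that [seq_near_normc] takes to pass from sequences
    to continuity. *)
Lemma Cint_dct (f_ : nat -> T -> R[i]) f (G : T -> R) :
  (forall j, Cmeasurable (f_ j)) ->
  mu.-integrable setT (EFin \o G) -> (forall j x, Normc.normc (f_ j x) <= G x) ->
  (forall x, Normc.normc (f_ j x - f x) @[j --> \oo] --> 0) ->
  Normc.normc (Cint (f_ j) - Cint f) @[j --> \oo] --> 0.
Proof.
move=> mf iG fG cf.
have cRe x : complex.Re (f_ j x) @[j --> \oo] --> complex.Re (f x).
  apply/cvgrPdist_le => e e0; have := cf x; move/cvgr0_norm_le => /(_ e e0).
  apply: filterS => j; rewrite ger0_norm ?normc_ge0// => h.
  by apply: le_trans h; rewrite distrC -ReN -ReD ler_normRe.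
have cIm x : complex.Im (f_ j x) @[j --> \oo] --> complex.Im (f x).
  apply/cvgrPdist_le => e e0; have := cf x; move/cvgr0_norm_le => /(_ e e0).
  apply: filterS => j; rewrite ger0_norm ?normc_ge0// => h.
  by apply: le_trans h; rewrite distrC -ImN -ImD ler_normIm.
have hRe : \int[mu]_x complex.Re (f_ j x) @[j --> \oo] --> \int[mu]_x complex.Re (f x).
  apply: (Rintegral_dct _ iG) => // [j|j x]; first by have [] := mf j.
  exact: le_trans (ler_normRe _) (fG _ _).
have hIm : \int[mu]_x complex.Im (f_ j x) @[j --> \oo] --> \int[mu]_x complex.Im (f x).
  apply: (Rintegral_dct _ iG) => // [j|j x]; first by have [] := mf j.
  exact: le_trans (ler_normIm _) (fG _ _).
apply: (squeeze_cvgr (f := fun=> 0)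
  (h := fun j => `|\int[mu]_x complex.Re (f_ j x) - \int[mu]_x complex.Re (f x)| +
            `|\int[mu]_x complex.Im (f_ j x) - \int[mu]_x complex.Im (f x)|)).
- by apply: nearW => j; rewrite normc_ge0 (le_trans (normc_le_ReIm _))//= ?ReD ?ImD ?ReN ?ImN.
- exact: cvg_cst.
- rewrite -[X in _ --> X](addr0 0); apply: cvgD.
    by rewrite -(@normr0 _ R); apply: cvg_norm; apply/subr_cvg0.
  by rewrite -(@normr0 _ R); apply: cvg_norm; apply/subr_cvg0.
Qed.

End complex_integral.

(** * Fubini's theorem under a bound of product form *)

Section dominated_fubini.
Context d1 d2 (T1 : measurableType d1) (T2 : measurableType d2) (R : realType).
Context (m1 : {sigma_finite_measure set T1 -> \bar R})
        (m2 : {sigma_finite_measure set T2 -> \bar R}).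

Section real.
Context (f : T1 * T2 -> R) (G1 : T1 -> R) (G2 : T2 -> R).
Hypothesis mf : measurable_fun setT f.
Hypothesis iG1 : m1.-integrable setT (EFin \o G1).
Hypothesis iG2 : m2.-integrable setT (EFin \o G2).
Hypothesis fG : forall x y, `|f (x, y)| <= G1 x * G2 y.

(** A bound [G1 x * G2 y] is what the kernels below offer: a bounded function times a Gaussian,
    which factors over the coordinates. *)
Lemma prod_dominated_integrable : (m1 \x m2)%E.-integrable setT (EFin \o f).
Proof.
apply/integrable12ltyP; first exact/measurable_EFinP.
have [mG1 _] := integrableP _ _ _ iG1; have [mG2 _] := integrableP _ _ _ iG2.
apply: (@le_lt_trans _ _ (\int[m1]_x (`|(G1 x)%:E| * \int[m2]_y `|(G2 y)%:E|))%E).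
  apply: ge0_le_integral => //.
  - by move=> x _; exact: integral_ge0.
  - apply: (@measurable_fun_fubini_tonelli_F _ _ _ _ _ m2 (fun z => `|(f z)%:E|%E)) => //.
    by apply: measurableT_comp => //; exact/measurable_EFinP.
  - by apply: emeasurable_funM => //; exact: measurableT_comp.
  move=> x _; rewrite -ge0_integralZl//; last exact: measurableT_comp.
  apply: ge0_le_integral => //.
  - apply: measurableT_comp => //; apply/measurable_EFinP.
    exact: (measurableT_comp mf (measurable_pair1 x)).
  - by apply: emeasurable_funM => //; exact: measurableT_comp.
  move=> y _ /=; rewrite lee_fin -normrM; exact: (le_trans (fG x y) (ler_norm _)).
rewrite ge0_integralZr//; last 2 first.
  exact: measurableT_comp.
  exact: integral_ge0.
have /integrableP[_ l1] := iG1; have /integrableP[_ l2] := iG2.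
by rewrite lte_mul_pinfty// ?integral_ge0// ge0_fin_numE// integral_ge0.
Qed.

(** Integrability on the product would give this only for almost every x. The product bound gives it
    for all x, so that the inner integrals are finite everywhere and [fineK] applies to each of
    them. *)
Lemma prod_dominated_integrable1 x : m2.-integrable setT (fun y => (f (x, y))%:E).
Proof.
apply: (le_integrable measurableT _ _ (integrable_mull (G1 x) iG2)).
  apply/measurable_EFinP; exact: (measurableT_comp mf (measurable_pair1 x)).
by move=> y _ /=; rewrite lee_fin; exact: (le_trans (fG x y) (ler_norm _)).
Qed.

Lemma prod_dominated_integrable2 y : m1.-integrable setT (fun x => (f (x, y))%:E).
Proof.
apply: (le_integrable measurableT _ _ (integrable_mull (G2 y) iG1)).
  apply/measurable_EFinP; exact: (measurableT_comp mf (measurable_pair2 y)).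
by move=> x _ /=; rewrite lee_fin mulrC; exact: (le_trans (fG x y) (ler_norm _)).
Qed.

Lemma Rintegral_fubini1 :
  \int[(m1 \x m2)%E]_z f z = \int[m1]_x (\int[m2]_y f (x, y)).
Proof.
rewrite /Rintegral -(integral12_prod_meas1 prod_dominated_integrable).
congr fine; apply: eq_integral => x _; rewrite fineK//.
by apply: integrable_fin_num => //; exact: prod_dominated_integrable1.
Qed.

Lemma Rintegral_fubini2 :
  \int[(m1 \x m2)%E]_z f z = \int[m2]_y (\int[m1]_x f (x, y)).
Proof.
rewrite /Rintegral -(integral21_prod_meas1 prod_dominated_integrable).
congr fine; apply: eq_integral => x _; rewrite fineK//.
by apply: integrable_fin_num => //; exact: prod_dominated_integrable2.
Qed.

Lemma measurable_Rintegral2 : measurable_fun setT (fun y => \int[m1]_x f (x, y)).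
Proof.
apply: (measurableT_comp (@fine_measurable _ _ measurableT)) => //.
exact: (measurable_fubini_G prod_dominated_integrable).
Qed.

End real.

Section complex.
Context (f : T1 * T2 -> R[i]) (G1 : T1 -> R) (G2 : T2 -> R).
Hypothesis mf : Cmeasurable f.
Hypothesis iG1 : m1.-integrable setT (EFin \o G1).
Hypothesis iG2 : m2.-integrable setT (EFin \o G2).
Hypothesis fG : forall x y, Normc.normc (f (x, y)) <= G1 x * G2 y.

Let fGRe x y : `|complex.Re (f (x, y))| <= G1 x * G2 y.
Proof. exact: le_trans (ler_normRe _) (fG x y). Qed.

Let fGIm x y : `|complex.Im (f (x, y))| <= G1 x * G2 y.
Proof. exact: le_trans (ler_normIm _) (fG x y). Qed.

Lemma Cint_fubini1 : Cint (m1 \x m2)%E f = Cint m1 (fun x => Cint m2 (fun y => f (x, y))).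
Proof.
have [mRe mIm] := mf.
apply: complex_eqP => /=.
  exact: (Rintegral_fubini1 mRe iG1 iG2 fGRe).
exact: (Rintegral_fubini1 mIm iG1 iG2 fGIm).
Qed.

Lemma Cint_fubini2 : Cint (m1 \x m2)%E f = Cint m2 (fun y => Cint m1 (fun x => f (x, y))).
Proof.
have [mRe mIm] := mf.
apply: complex_eqP => /=.
  exact: (Rintegral_fubini2 mRe iG1 iG2 fGRe).
exact: (Rintegral_fubini2 mIm iG1 iG2 fGIm).
Qed.

Lemma Cmeasurable_Cint2 : Cmeasurable (fun y => Cint m1 (fun x => f (x, y))).
Proof.
have [mRe mIm] := mf; split => /=.
  exact: (measurable_Rintegral2 mRe iG1 iG2 fGRe).
exact: (measurable_Rintegral2 mIm iG1 iG2 fGIm).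
Qed.

Lemma Cintegrable_prod : Cintegrable (m1 \x m2)%E f.
Proof.
have [mRe mIm] := mf; split.
  exact: (prod_dominated_integrable mRe iG1 iG2 fGRe).
exact: (prod_dominated_integrable mIm iG1 iG2 fGIm).
Qed.

End complex.

End dominated_fubini.

Section snoc_integral.
Context (R : realType) (n : nat).
Local Notation lebT := (@lebesgue_measure R).

Context (f : 'rV[R]_n.+1 -> R[i]) (G1 : 'rV[R]_n -> R) (G2 : R -> R).
Hypothesis mf : Cmeasurable f.
Hypothesis iG1 : (lebesgue_rV R n).-integrable setT (EFin \o G1).
Hypothesis iG2 : lebT.-integrable setT (EFin \o G2).
Hypothesis fG : forall x t, Normc.normc (f (snoc_rV (x, t))) <= G1 x * G2 t.

Let mfs : Cmeasurable (f \o @snoc_rV R n).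
Proof. exact: Cmeasurable_comp (@measurable_snoc_rV R n) mf. Qed.

Lemma Cint_snoc : Cint (lebesgue_rV R n.+1) f =
  Cint (lebesgue_rV R n \x lebT)%E (f \o @snoc_rV R n).
Proof.
have [h1 h2] := Cintegrable_prod mfs iG1 iG2 fG.
have [mRe mIm] := mf.
by apply: complex_eqP => /=; rewrite /Rintegral integral_snoc//; exact/measurable_EFinP.
Qed.

Lemma Cint_snoc2 : Cint (lebesgue_rV R n.+1) f =
  Cint lebT (fun t => Cint (lebesgue_rV R n) (fun x => f (snoc_rV (x, t)))).
Proof. by rewrite Cint_snoc (Cint_fubini2 mfs iG1 iG2 fG). Qed.

Lemma Cmeasurable_Cint_snoc :
  Cmeasurable (fun t : measurableTypeR R => Cint (lebesgue_rV R n) (fun x => f (snoc_rV (x, t)))).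
Proof. exact: (Cmeasurable_Cint2 (m2 := lebT) mfs iG1 iG2 fG). Qed.

End snoc_integral.

(** * Topology and measurability on R^n *)

Section rV_topology.
Context (R : realType).

Lemma ball_rV n (x : 'rV[R]_n) e y :
  ball x e y <-> 0 < e /\ forall i, `|x 0 i - y 0 i| < e.
Proof.
split=> [[e0 h]|[e0 h]]; split => //; first by move=> i; exact: h.
by move=> i j; rewrite (ord1 i); exact: h.
Qed.

(** The sigma-algebra comes from the coordinates, the topology from the sup norm. They meet in the
    cubes with rational centre and radius, countably many of which fill any open set. *)
Lemma open_measurable_rV n (U : set 'rV[R]_n) : open U -> measurable U.
Proof.
move=> oU.
pose B (p : 'rV[rat]_n * rat) : set 'rV[R]_n :=
  [set x | forall i, `|ratr (p.1 0 i) - x 0 i| < ratr p.2].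
(* Cubes that leave [U] are replaced by the empty set, so the union can run over the whole countable
   type of pairs. *)
pose G p := if `[< B p `<=` U >] then B p else set0.
have -> : U = \bigcup_p G p.
  apply/seteqP; split => [x Ux|x [p _]]; last first.
    by rewrite /G; case: ifPn => [/asboolP|//]; exact.
  have /nbhs_ballP[e /= e0 xeU] : nbhs x U by exact: open_nbhs_nbhs.
  (* The rational centre will lie within r of x, so the cube of radius r around it stays within 2 r
     < e of x. *)
  have [r] : exists r : rat, ratr r \in `]0, e / 2[.
    by apply: rat_in_itvoo; rewrite divr_gt0.
  rewrite in_itv /= => /andP[r0 re].
  have /choice[c cP] : forall i : 'I_n, exists c : rat, `|ratr c - x 0 i| < ratr r.
    move=> i; have [c] : exists c : rat, ratr c \in `]x 0 i - ratr r, x 0 i + ratr r[.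
      by apply: rat_in_itvoo; rewrite ltrD2l (lt_trans _ r0)// oppr_lt0.
    rewrite in_itv /= => /andP[c1 c2]; exists c.
    by rewrite ltr_distl c1 c2.
  exists (\row_i c i, r) => //; rewrite /G.
  have xB : B (\row_i c i, r) x by move=> i /=; rewrite mxE; exact: cP.
  case: ifPn => // /asboolP; case => y yB; apply: xeU; apply/ball_rV; split => // i.
  have := yB i; have := xB i; rewrite /= distrC => h1 h2.
  rewrite (splitr e) -(subrKA (ratr ((\row_i c i) 0 i))).
  by rewrite (le_lt_trans (ler_normD _ _))// ltrD// (lt_trans _ re).
apply: countable_bigcupT_measurable => // p; rewrite /G; case: ifPn => // _.
rewrite (_ : B p = \bigcap_(i in setT)
    (fun x : 'rV[R]_n => `|ratr (p.1 0 i) - x 0 i|) @^-1` `]-oo, ratr p.2[); last first.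
  by apply/seteqP; split => x /= h i => [_|]; have := h i; rewrite /= in_itv /= => // /(_ Logic.I).
apply: fin_bigcap_measurable => // i _; rewrite -[X in measurable X]setTI.
apply: (_ : measurable_fun setT _) => //.
apply: measurableT_comp => //; apply: measurable_funB => //.
exact: measurable_rV_coord.
Qed.

Lemma continuous_measurable_rV n (f : 'rV[R]_n -> R) :
  continuous f -> measurable_fun setT f.
Proof.
move=> /continuousP cf; apply: (measurability _ (RGenOpens.measurableE R)).
move=> /= _ [_ [a [b ->]] <-]; rewrite setTI; apply: open_measurable_rV.
by apply: cf; exact: interval_open.
Qed.

Lemma lower_semicontinuous_measurable_rV n (f : 'rV[R]_n -> \bar R) :
  lower_semicontinuous f -> measurable_fun setT f.
Proof.
move=> scif; apply: (measurability _ (ErealGenOInfty.measurableE R)).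
move=> /= _ [_ [a ->]] <-; rewrite setTI; apply: open_measurable_rV.
by rewrite preimage_itvoy; move/lower_semicontinuousP : scif; exact.
Qed.

Lemma normC_normc (z : R[i]) : `|z| = (Normc.normc z)%:C.
Proof. by case: z. Qed.

Lemma cvg_normcP (T : Type) (F : set_system T) (FF : Filter F) (f : T -> R[i]) l :
  (f x : R[i]^o) @[x --> F] --> (l : R[i]^o) <->
  forall e : R, 0 < e -> \forall x \near F, Normc.normc (l - f x) < e.
Proof.
split=> [/cvgrPdist_lt h e e0|h].
  have := h e%:C; rewrite ltcR => /(_ e0); apply: filterS => x.
  by rewrite normC_normc ltcR.
apply/cvgrPdist_lt => -[a b]; rewrite ltcE /= => /andP[/eqP -> a0].
by move: (h a a0); apply: filterS => x; rewrite normC_normc ltcR.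
Qed.

Lemma continuous_normcP (T : topologicalType) (f : T -> R[i]) :
  continuous (f : T -> R[i]^o) <->
  forall x (e : R), 0 < e -> \forall y \near x, Normc.normc (f x - f y) < e.
Proof.
by split=> [h x|h x]; apply/(@cvg_normcP _ (nbhs x) _ f (f x)); exact: h.
Qed.

Lemma continuous_Re (T : topologicalType) (f : T -> R[i]) :
  continuous (f : T -> R[i]^o) -> continuous (fun x => complex.Re (f x)).
Proof.
move=> /continuous_normcP h x; apply/cvgrPdist_lt => e e0.
by move: (h x e e0); apply: filterS => y; apply: le_lt_trans; rewrite -ReN -ReD ler_normRe.
Qed.

Lemma continuous_Im (T : topologicalType) (f : T -> R[i]) :
  continuous (f : T -> R[i]^o) -> continuous (fun x => complex.Im (f x)).
Proof.
move=> /continuous_normcP h x; apply/cvgrPdist_lt => e e0.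
by move: (h x e e0); apply: filterS => y; apply: le_lt_trans; rewrite -ImN -ImD ler_normIm.
Qed.

Lemma continuous_Cmeasurable n (f : 'rV[R]_n -> R[i]) :
  continuous (f : 'rV[R]_n -> R[i]^o) -> Cmeasurable f.
Proof.
by move=> cf; split; apply: continuous_measurable_rV;
  [exact: continuous_Re|exact: continuous_Im].
Qed.

(** Bridges dominated convergence, which speaks of sequences, and continuity. If the bound failed
    near x, points chosen in the balls of radius 1/(j+1) would form a sequence contradicting the
    hypothesis. *)
Lemma seq_near_normc (T : pseudoMetricType R) (f : T -> R[i]) x :
  (forall u : nat -> T, u j @[j --> \oo] --> x ->
     Normc.normc (f (u j) - f x) @[j --> \oo] --> 0) ->
  forall e : R, 0 < e -> \forall y \near x, Normc.normc (f x - f y) < e.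
Proof.
move=> h e e0; apply: contrapT => nh.
have /choice[u uP] : forall j : nat, exists y, ball x j.+1%:R^-1 y /\ e <= Normc.normc (f x - f y).
  move=> j; apply: contrapT => /forallNP nj; apply: nh.
  apply/nbhs_ballP; exists j.+1%:R^-1; first by rewrite /= invr_gt0.
  by move=> y xy; rewrite ltNge; apply/negP => ey; exact: (nj y).
have ux : u j @[j --> \oo] --> x.
  apply/cvg_ballP => r r0; near=> j.
  apply: (@le_ball _ _ _ j.+1%:R^-1); last by have [] := uP j.
  apply: ltW; near: j; exact: (near_infty_natSinv_lt (PosNum r0)).
have /cvgr0_norm_lt/(_ _ e0)[N _ hN] := h u ux.
have := hN N (leqnn N); rewrite /= ger0_norm ?normc_ge0// normcB.
by apply/negP; rewrite -leNgt; have [] := uP N.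
Unshelve. all: by end_near. Qed.

Lemma continuous_dot n (y : 'rV[R]_n) : continuous (fun xi : 'rV[R]_n => dot xi y).
Proof.
move=> xi; rewrite /dot; apply: (cvg_big (@add_continuous R)) => [|i _]; first exact: nbhs_filter.
exact: (cvgM (@coord_continuous R 1 n 0 i xi) (cvg_cst _)).
Qed.

Lemma nonexpansive_continuous (T U : pseudoMetricType R) (f : T -> U) :
  (forall x e y, ball x e y -> ball (f x) e (f y)) -> continuous f.
Proof.
move=> h x; apply/cvg_ballP => e e0; near=> y; apply: h.
by near: y; exact: nbhsx_ballx.
Unshelve. all: by end_near. Qed.

Lemma continuous_snoc_l n (t : R) :
  continuous (fun x : 'rV[R]_n => snoc_rV (x, t)).
Proof.
apply: nonexpansive_continuous => x e y /ball_rV[e0 xy]; apply/ball_rV; split => // i.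
case: (unliftP ord_max i) => [j ->|->]; first by rewrite !snoc_rV_lift.
by rewrite !snoc_rV_max subrr normr0.
Qed.

Lemma continuous_snoc_r n (x : 'rV[R]_n) :
  continuous (fun t : R => snoc_rV (x, t)).
Proof.
apply: nonexpansive_continuous => t e s ts.
have e0 : 0 < e by exact: le_lt_trans (normr_ge0 _) ts.
apply/ball_rV; split => // i.
case: (unliftP ord_max i) => [j ->|->]; last by rewrite !snoc_rV_max.
by rewrite !snoc_rV_lift subrr normr0.
Qed.

Lemma continuous_init n : continuous (@init_rV R n).
Proof.
apply: nonexpansive_continuous => x e y /ball_rV[e0 xy]; apply/ball_rV; split => // i.
by rewrite !mxE.
Qed.

End rV_topology.

(** * Gaussians on the line *)

Section calculus.
Context (R : realType).
Local Notation leb := (@lebesgue_measure R).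

Lemma is_derive_under_integral (f df : R -> R -> R) (G : R -> R) (a : R) :
  (forall x, leb.-integrable setT (EFin \o f x)) ->
  (forall x y : R, is_derive x 1 (f ^~ y) (df x y)) ->
  leb.-integrable setT (EFin \o G) ->
  (forall x y, `|df x y| <= G y) ->
  is_derive a 1 (fun x => \int[leb]_y f x y) (\int[leb]_y df a y).
Proof.
move=> intf derf intG dfG.
(* The bound by [G] is global in x, so any open interval around [a] serves; this one has radius
   1. *)
have Ia : (`]a - 1, a + 1[%classic : set R) a.
  by rewrite /= in_itv /= ltrDl ltr01 ltrBlDr ltrDl ltr01.
have G0 y : 0 <= G y by exact: le_trans (normr_ge0 _) (dfG 0 y).
have dE x y : partial1of2 f x y = df x y.
  by rewrite partial1of2E; exact: (@derive_val _ _ _ _ _ _ _ (derf x y)).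
have dG x y : (`]a - 1, a + 1[%classic : set R) x -> [set: R] y -> `|partial1of2 f x y| <= G y.
  by move=> _ _; rewrite dE.
have df1 x y : (`]a - 1, a + 1[%classic : set R) x -> [set: R] y ->
  derivable (f ^~ y) x 1 by move=> _ _; exact: ex_derive.
apply: DeriveDef.
  exact: (derivable_under_integral measurableT Ia (fun x _ => intf x) df1 G0 intG dG).
rewrite -derive1E.
rewrite (differentiation_under_integral measurableT Ia (fun x _ => intf x) df1 G0 intG dG).
by apply: eq_Rintegral => y _; rewrite dE.
Qed.

(** The fundamental theorem of calculus on [-j, j]: the integrals tend to the full one by dominated
    convergence, the boundary terms tend to 0. *)
Lemma integral_derive_eq0 (u du : R -> R) :
  (forall x : R, is_derive x 1 u (du x)) -> continuous du ->
  leb.-integrable setT (EFin \o du) ->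
  u j%:R @[j --> \oo] --> 0 -> u (- j%:R) @[j --> \oo] --> 0 ->
  \int[leb]_x du x = 0.
Proof.
move=> udu cdu idu up um.
pose D j : set R := `[(- j%:R)%R, j%:R]%classic.
have mdu : measurable_fun setT du by apply: continuous_measurable_fun.
have h1 : \int[leb]_x (du \_ (D j)) x @[j --> \oo] --> \int[leb]_x du x.
  apply: (Rintegral_dct (mu := leb) (G := fun x => `|du x|)).
  - move=> j; have mD : measurable (D j) by exact: measurable_itv.
    exact: (measurable_restrictT du mD).1 (measurable_funTS mdu).
  - exact: (integrable_norm idu).
  - by move=> j x; rewrite /patch; case: ifPn => // _; rewrite normr0.
  - move=> x; apply: cvg_near_cst; near=> j.
    rewrite /patch mem_set// /D /= in_itv /= -ler_norml.
    by near: j; exact: nbhs_infty_ger.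
have h2 : \int[leb]_x (du \_ (D j)) x @[j --> \oo] --> 0.
  have : u j%:R - u (- j%:R) @[j --> \oo] --> (0 : R).
    by rewrite -[X in _ --> X](subrr 0); exact: cvgB.
  apply: cvg_trans; apply: near_eq_cvg; near=> j.
  have j0 : (0 : R) < j%:R by near: j; exact: nbhs_infty_gtr.
  rewrite -Rintegral_mkcond /Rintegral /D.
  rewrite (@continuous_FTC2 _ du u) //.
  - by rewrite (lt_trans _ j0)// oppr_lt0.
  - exact: continuous_subspaceT.
  - have cu x : {for x, continuous u}.
      by apply: differentiable_continuous; apply/derivable1_diffP; apply: ex_derive.
    split; first by move=> x _; apply: ex_derive.
      by apply: cvg_at_right_filter; exact: cu.
    by apply: cvg_at_left_filter; exact: cu.
  - by move=> x _; rewrite derive1E; exact: (@derive_val _ _ _ _ _ _ _ (udu x)).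
by rewrite -(cvg_lim (@Rhausdorff R) h1) (cvg_lim (@Rhausdorff R) h2).
Unshelve. all: by end_near. Qed.

End calculus.

(** * Moments and Fourier transform of the normal density *)

Section gaussian.
Context (R : realType).
Local Notation leb := (@lebesgue_measure R).
Implicit Types b s t : R.

Lemma normal_pdf_gt0E b s t : 0 < s ->
  normal_pdf b s t = normal_peak s * expR (- (t - b) ^+ 2 / (s ^+ 2 *+ 2)).
Proof. by move=> s0; rewrite normal_pdfE ?gt_eqF. Qed.

Lemma normal_peak_sqrt2 s : normal_peak s = Num.sqrt 2 * normal_peak (Num.sqrt 2 * s).
Proof.
rewrite /normal_peak exprMn sqr_sqrtr//.
rewrite (_ : 2 * s ^+ 2 * pi *+ 2 = 2 * (s ^+ 2 * pi *+ 2)); last first.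
  by rewrite -mulrA mulrnAr.
by rewrite [in RHS]sqrtrM// invfM mulrA mulfV ?mul1r// sqrtr_eq0 -ltNge.
Qed.

(* x <= exp x absorbs polynomial factors into a Gaussian of doubled variance. *)
Lemma sqr_normal_pdf_le b s t : 0 < s ->
  (t - b) ^+ 2 * normal_pdf b s t <= 4 * s ^+ 2 * Num.sqrt 2 * normal_pdf b (Num.sqrt 2 * s) t.
Proof.
move=> s0; have s20 : 0 < Num.sqrt 2 * s by rewrite mulr_gt0// sqrtr_gt0.
rewrite !normal_pdf_gt0E// (normal_peak_sqrt2 s) exprMn sqr_sqrtr//.
set K := normal_peak _; have K0 : 0 <= K by exact: normal_peak_ge0.
set r2 := Num.sqrt 2; have r20 : 0 <= r2 by exact: sqrtr_ge0.
set x := (t - b) ^+ 2 / (4 * s ^+ 2).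
have s2 : s ^+ 2 != 0 by rewrite expf_neq0// gt_eqF.
have -> : - (t - b) ^+ 2 / (s ^+ 2 *+ 2) = - x - x by rewrite /x; field; rewrite gt_eqF.
have -> : - (t - b) ^+ 2 / (2 * s ^+ 2 *+ 2) = - x by rewrite /x; field; rewrite gt_eqF.
have -> : (t - b) ^+ 2 = 4 * s ^+ 2 * x by rewrite /x; field; rewrite gt_eqF.
rewrite expRD.
have -> : 4 * s ^+ 2 * x * (r2 * K * (expR (- x) * expR (- x))) =
  (4 * s ^+ 2 * r2 * (K * expR (- x))) * (x * expR (- x)) by ring.
rewrite ler_piMr//.
  by rewrite !mulr_ge0 ?expR_ge0 ?sqr_ge0// ltW.
rewrite expRN ler_pdivrMr ?expR_gt0// mul1r.
by apply: le_trans (expR_ge1Dx x); rewrite lerDr.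
Qed.

(** The inequality |y| <= 1 + y^2 reduces the first moment to the second. *)
Lemma abs_normal_pdf_le b s t : 0 < s ->
  `|t - b| * normal_pdf b s t <=
    normal_pdf b s t + 4 * s ^+ 2 * Num.sqrt 2 * normal_pdf b (Num.sqrt 2 * s) t.
Proof.
move=> s0; apply: (@le_trans _ _ ((1 + (t - b) ^+ 2) * normal_pdf b s t)).
  rewrite ler_wpM2r ?normal_pdf_ge0// -[in leRHS]real_normK ?num_real//.
  have := sqr_ge0 (`|t - b| - 1); have := normr_ge0 (t - b).
  by move: `|t - b| => y y0; nra.
by rewrite mulrDl mul1r lerD2l sqr_normal_pdf_le.
Qed.

Lemma integrable_abs_normal_pdf_ub b s :
  leb.-integrable setT (EFin \o (fun t => normal_pdf b s t +
    4 * s ^+ 2 * Num.sqrt 2 * normal_pdf b (Num.sqrt 2 * s) t)).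
Proof.
rewrite (_ : _ \o _ = (fun t => (normal_pdf b s t)%:E) \+
   (fun t => (4 * s ^+ 2 * Num.sqrt 2 * normal_pdf b (Num.sqrt 2 * s) t)%:E))%E //.
apply: integrableD => //; first exact: integrable_normal_pdf.
apply: integrable_mull; exact: integrable_normal_pdf.
Qed.

Lemma is_derive_normal_pdf b s t : 0 < s ->
  is_derive t 1 (normal_pdf b s) (- (t - b) / s ^+ 2 * normal_pdf b s t).
Proof.
move=> s0; rewrite (_ : normal_pdf b s =
    (fun t => normal_peak s * expR (- (t - b) ^+ 2 / (s ^+ 2 *+ 2)))).
  apply: is_derive_eq; rewrite /GRing.scale /=; field.
  by rewrite gt_eqF.
by apply/funext => x; rewrite normal_pdf_gt0E.
Qed.


Lemma continuous_normal_pdf_gt0 b s : 0 < s -> continuous (normal_pdf b s).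
Proof. by move=> s0; apply: continuous_normal_pdf; rewrite gt_eqF. Qed.

Lemma measurable_cos_lin (eta th b : R) :
  measurable_fun setT (fun t : R => cos (eta * (t - b) + th)).
Proof.
apply: (measurableT_comp (continuous_measurable_fun (@continuous_cos R))).
by apply: measurable_funD => //; apply: measurable_funM => //; exact: measurable_funB.
Qed.

Lemma measurable_sin_lin (eta th b : R) :
  measurable_fun setT (fun t : R => sin (eta * (t - b) + th)).
Proof.
apply: (measurableT_comp (continuous_measurable_fun (@continuous_sin R))).
by apply: measurable_funD => //; apply: measurable_funM => //; exact: measurable_funB.
Qed.

Lemma integrable_cos_normal_pdf b s eta th :
  leb.-integrable setT (EFin \o (fun t => cos (eta * (t - b) + th) * normal_pdf b s t)).
Proof.
apply: (le_integrable measurableT _ _ (integrable_normal_pdf b s)).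
  apply/measurable_EFinP; apply: measurable_funM; first exact: measurable_cos_lin.
  exact: measurable_normal_pdf.
move=> t _ /=; rewrite lee_fin normrM ler_piMl// ler_norml.
by rewrite cos_geN1 cos_le1.
Qed.

Lemma integrable_tsin_normal_pdf b s eta th : 0 < s ->
  leb.-integrable setT (EFin \o (fun t => (t - b) * sin (eta * (t - b) + th) * normal_pdf b s t)).
Proof.
move=> s0; apply: (le_integrable measurableT _ _ (integrable_abs_normal_pdf_ub b s)).
  apply/measurable_EFinP; apply: measurable_funM; last exact: measurable_normal_pdf.
  by apply: measurable_funM; [exact: measurable_funB|exact: measurable_sin_lin].
move=> t _ /=; rewrite lee_fin (le_trans _ (ler_norm _))//.
apply: (le_trans _ (abs_normal_pdf_le b t s0)).
rewrite 2!normrM (ger0_norm (normal_pdf_ge0 _ _ _)) ler_wpM2r ?normal_pdf_ge0//.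
by rewrite ler_piMr// ler_norml sin_geN1 sin_le1.
Qed.

(** By [abs_normal_pdf_le] the product of |t - b| and |u t| stays below a constant, so u decays at
    least like 1/|t - b|. Integer points are what [integral_derive_eq0] asks for. *)
Lemma normal_pdf_vanish b s (u : R -> R) : 0 < s ->
  (forall t, `|u t| <= normal_pdf b s t) ->
  u j%:R @[j --> \oo] --> 0 /\ u (- j%:R) @[j --> \oo] --> 0.
Proof.
move=> s0 hu.
set K := normal_peak s + 4 * s ^+ 2 * Num.sqrt 2 * normal_peak (Num.sqrt 2 * s).
have K0 : 0 <= K.
  by rewrite addr_ge0 ?normal_peak_ge0// !mulr_ge0 ?normal_peak_ge0// ltW.
have uK t : `|t - b| * `|u t| <= K.
  apply: (@le_trans _ _ (`|t - b| * normal_pdf b s t)); first by rewrite ler_wpM2l.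
  apply: (le_trans (abs_normal_pdf_le b t s0)); rewrite lerD//.
    by rewrite normal_pdf_ub// gt_eqF.
  rewrite ler_wpM2l ?normal_pdf_ub ?gt_eqF//; last by rewrite mulr_gt0// sqrtr_gt0.
  by rewrite !mulr_ge0// ltW.
have main (v : nat -> R) : (forall j, `|v j| = j%:R) -> u (v j) @[j --> \oo] --> 0.
  move=> vj; apply/cvgr0Pnorm_le => e e0; near=> j.
  have jb : `|b| + K / e < j%:R by near: j; exact: nbhs_infty_gtr.
  have h : K / e < `|v j - b|.
    have := lerB_dist (v j) b; rewrite vj; move: jb; rewrite -ltrBrDl.
    exact: lt_le_trans.
  have vb : 0 < `|v j - b| by apply: le_lt_trans h; rewrite divr_ge0// ltW.
  rewrite -(ler_pM2l vb) (le_trans (uK _))// -ler_pdivrMr//; exact: ltW.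
split; apply: main => j; first by rewrite normr_nat.
by rewrite normrN normr_nat.
Unshelve. all: by end_near. Qed.

(** Integration by parts: (t - b) times the density is -s^2 times its derivative. It is carried out
    by integrating the derivative [du] of sine times density to 0. *)
Lemma integral_tsin_normal_pdf b s eta th : 0 < s ->
  \int[leb]_t ((t - b) * sin (eta * (t - b) + th) * normal_pdf b s t) =
  s ^+ 2 * eta * \int[leb]_t (cos (eta * (t - b) + th) * normal_pdf b s t).
Proof.
move=> s0; have s20 : s ^+ 2 != 0 by rewrite expf_neq0// gt_eqF.
pose u t := sin (eta * (t - b) + th) * normal_pdf b s t.
pose du t := eta * (cos (eta * (t - b) + th) * normal_pdf b s t) -
  (s ^+ 2)^-1 * ((t - b) * sin (eta * (t - b) + th) * normal_pdf b s t).
have dudu (t : R) : is_derive t 1 u (du t).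
  have := is_derive_normal_pdf b t s0 => dp.
  rewrite /u; apply: is_derive_eq; rewrite /GRing.scale /= /du; field.
  by rewrite gt_eqF.
have iC := integrable_cos_normal_pdf b s eta th.
have iS := integrable_tsin_normal_pdf b eta th s0.
have idu : leb.-integrable setT (EFin \o du).
  have i1 := integrable_mull eta iC; have i2 := integrable_mull (s ^+ 2)^-1 iS.
  exact: (integrableB measurableT i1 i2).
have cdu : continuous du.
  have dE t : derivable du t 1.
    have dp := is_derive_normal_pdf b t s0.
    by rewrite /du; apply: ex_derive.
  by move=> t; apply: differentiable_continuous; apply/derivable1_diffP.
have [h1 h2] : u j%:R @[j --> \oo] --> 0 /\ u (- j%:R) @[j --> \oo] --> 0.
  apply: (normal_pdf_vanish (b := b) s0) => t.
  rewrite normrM (ger0_norm (normal_pdf_ge0 _ _ _)) ler_piMl ?normal_pdf_ge0//.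
  by rewrite ler_norml sin_geN1 sin_le1.
have := integral_derive_eq0 dudu cdu idu h1 h2.
rewrite /du RintegralB//; [|exact: integrable_mull..].
rewrite !RintegralZl// => /eqP; rewrite subr_eq0 => /eqP e.
by rewrite -mulrA e mulrA divff// mul1r.
Qed.

(** As a function of eta the integral [phi] satisfies phi' = -s^2 eta phi, by differentiation under
    the integral and [integral_tsin_normal_pdf]; hence phi times exp(s^2 eta^2 / 2) is constant. The
    free phase [th] lets one cosine formula cover both the real and the imaginary part of the
    complex transform. *)
Lemma normal_pdf_fourier b s eta th : 0 < s ->
  \int[leb]_t (cos (eta * (t - b) + th) * normal_pdf b s t) =
  cos th * expR (- (s ^+ 2 * eta ^+ 2 / 2)).
Proof.
move=> s0; pose phi eta := \int[leb]_t (cos (eta * (t - b) + th) * normal_pdf b s t).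
have dphi (x : R) : is_derive x 1 phi (- (s ^+ 2 * x) * phi x).
  have := @is_derive_under_integral R
    (fun x t => cos (x * (t - b) + th) * normal_pdf b s t)
    (fun x t => - ((t - b) * sin (x * (t - b) + th) * normal_pdf b s t))
    (fun t => normal_pdf b s t + 4 * s ^+ 2 * Num.sqrt 2 * normal_pdf b (Num.sqrt 2 * s) t) x.
  rewrite (_ : \int[leb]_y _ = - (s ^+ 2 * x) * phi x); last first.
    rewrite mulNr -integral_tsin_normal_pdf// -[RHS]mulN1r -RintegralZl//.
      by apply: eq_Rintegral => t _; rewrite mulN1r.
    exact: integrable_tsin_normal_pdf.
  apply.
  - by move=> y; exact: integrable_cos_normal_pdf.
  - by move=> y t; apply: is_derive_eq; rewrite /GRing.scale /=; ring.
  - exact: integrable_abs_normal_pdf_ub.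
  - move=> y t; rewrite normrN; apply: (le_trans _ (abs_normal_pdf_le b t s0)).
    rewrite 2!normrM (ger0_norm (normal_pdf_ge0 _ _ _)) ler_wpM2r ?normal_pdf_ge0//.
    by rewrite ler_piMr// ler_norml sin_geN1 sin_le1.
have cst := @is_derive_0_is_cst R (fun x => phi x * expR (s ^+ 2 * x ^+ 2 / 2)) eta 0.
have e : phi eta * expR (s ^+ 2 * eta ^+ 2 / 2) = phi 0 * expR (s ^+ 2 * 0 ^+ 2 / 2).
  apply: cst => x; have d := dphi x.
  by apply: is_derive_eq; rewrite /GRing.scale /=; field.
move: e; rewrite expr0n /= mulr0 mul0r expR0 mulr1.
have -> : phi 0 = cos th.
  rewrite /phi; under eq_Rintegral do rewrite mul0r add0r.
  rewrite RintegralZl//; last exact: integrable_normal_pdf.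
  by rewrite /Rintegral integral_normal_pdf /= mulr1.
by move=> <-; rewrite -[RHS]mulrA -expRD subrr expR0 mulr1.
Qed.

End gaussian.

(** * Fourier inversion on the line *)

Section inversion.
Context (R : realType).
Local Notation leb := (@lebesgue_measure R).

Lemma Cint_cexp_normal_pdf (b s eta : R) : 0 < s ->
  Cint leb (fun t => cexp_i (eta * t) * (normal_pdf b s t)%:C) =
  cexp_i (eta * b) * (expR (- (s ^+ 2 * eta ^+ 2 / 2)))%:C.
Proof.
move=> s0; apply: complex_eqP; rewrite ?ReM ?ImM /= mulr0 ?subr0 ?add0r.
  rewrite -(@normal_pdf_fourier _ b)//; apply: eq_Rintegral => t _.
  by rewrite /= ?ReM /= mulr0 subr0 -mulrDr subrK.
have -> : sin (eta * b) = cos (eta * b - pi / 2).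
  by rewrite cosB cos_pihalf sin_pihalf mulr0 add0r mulr1.
rewrite -(@normal_pdf_fourier _ b)//; apply: eq_Rintegral => t _.
rewrite /= ?ImM /= mulr0 add0r addrA -mulrDr subrK.
by rewrite cosB cos_pihalf sin_pihalf mulr0 add0r mulr1.
Qed.

Lemma Cmeasurable_normal_pdf (b s : R) :
  Cmeasurable (fun t : measurableTypeR R => (normal_pdf b s t)%:C).
Proof. by apply: Cmeasurable_real; exact: measurable_normal_pdf. Qed.

Lemma normc_normal_pdf (b s t : R) : Normc.normc (normal_pdf b s t)%:C = normal_pdf b s t.
Proof. by rewrite normc_real ger0_norm// normal_pdf_ge0. Qed.

Lemma Cint_normal_pdf (b s : R) : 0 < s -> Cint leb (fun t => (normal_pdf b s t)%:C) = 1.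
Proof.
move=> s0; have := @Cint_cexp_normal_pdf b s 0 s0.
rewrite expr0n /= mulr0 mul0r oppr0 expR0 mulr1 mul0r.
have -> : cexp_i (0 : R) = 1 by rewrite /cexp_i cos0 sin0.
by move=> <-; apply: eq_Cint => t; rewrite mul0r /cexp_i cos0 sin0 mul1r.
Qed.

(** A Chebyshev argument in place of a split integral: continuity near a and boundedness far from it
    combine into |F t - F a| <= e/2 + K (t - a)^2 for all t, and the second moment of a narrow
    Gaussian is small. *)
Lemma normal_pdf_approx_id (F : R -> R[i]) (M a e : R) :
  Cmeasurable (F : measurableTypeR R -> R[i]) ->
  (forall t, Normc.normc (F t) <= M) ->
  (forall e : R, 0 < e -> \forall t \near a, Normc.normc (F a - F t) < e) ->
  0 < e ->
  exists2 s, 0 < s &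
    Normc.normc (Cint leb (fun t => F t * (normal_pdf a s t)%:C) - F a) <= e.
Proof.
move=> mF FM cF e0; have M0 : 0 <= M by exact: le_trans (normc_ge0 _) (FM a).
have e20 : 0 < e / 2 by rewrite divr_gt0.
have /nbhs_ballP[d /= d0 dF] := cF _ e20.
(* Where |t - a| >= d, the trivial bound 2 M is at most K (t - a)^2. *)
pose K := 2 * M / d ^+ 2.
have K0 : 0 <= K by rewrite divr_ge0 ?mulr_ge0 // ltW.
have Ft t : Normc.normc (F t - F a) <= e / 2 + K * (t - a) ^+ 2.
  have [td|td] := ltP `|t - a| d.
    rewrite normcB; apply: (@le_trans _ _ (e / 2)).
      by apply/ltW/dF; rewrite /ball /= distrC.
    by rewrite lerDl mulr_ge0// sqr_ge0.
  apply: (@le_trans _ _ (2 * M)).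
    by rewrite (le_trans (normcD _ _))// normc_opp mulr_natl mulr2n lerD.
  apply: (@le_trans _ _ (K * (t - a) ^+ 2)); last by rewrite lerDr ltW.
  rewrite /K -mulrA ler_peMr ?mulr_ge0// mulrC ler_pdivlMr ?exprn_gt0//.
  by rewrite mul1r -[leRHS]real_normK ?num_real// ler_pXn2r ?nnegrE// ltW.
clearbody K.
have [s s0 sK] : exists2 s, 0 < s & K * (4 * s ^+ 2 * Num.sqrt 2) <= e / 2.
  (* The factor 4 sqrt 2 is that of [sqr_normal_pdf_le]; adding 1 keeps the denominator positive
     when K = 0. *)
  pose s2 := e / 2 / (K * 4 * Num.sqrt 2 + 1).
  have D0 : 0 < K * 4 * Num.sqrt 2 + 1 by rewrite ltr_wpDl// !mulr_ge0.
  have s20 : 0 < s2 by rewrite divr_gt0.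
  exists (Num.sqrt s2); first by rewrite sqrtr_gt0.
  rewrite sqr_sqrtr; last exact: ltW.
  have -> : K * (4 * s2 * Num.sqrt 2) = (K * 4 * Num.sqrt 2) * s2 by ring.
  rewrite /s2 mulrCA -[leRHS]mulr1 ler_wpM2l//; first exact: ltW.
  by rewrite ler_pdivrMr// mul1r lerDl ler01.
have s20 : 0 < Num.sqrt 2 * s by rewrite mulr_gt0// sqrtr_gt0.
exists s => //.
have iF : Cintegrable leb (fun t => F t * (normal_pdf a s t)%:C).
  apply: (@Cint_dominated _ _ _ leb _ (fun t => M * normal_pdf a s t)).
  - by apply: CmeasurableM => //; exact: Cmeasurable_normal_pdf.
  - by apply: integrable_mull; exact: integrable_normal_pdf.
  - by move=> t; rewrite normcM normc_normal_pdf ler_wpM2r// normal_pdf_ge0.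
have ip : Cintegrable leb (fun t => (normal_pdf a s t)%:C).
  apply: (@Cint_dominated _ _ _ leb _ (normal_pdf a s)).
  - exact: Cmeasurable_normal_pdf.
  - exact: integrable_normal_pdf.
  - by move=> t; rewrite normc_normal_pdf.
rewrite -[X in _ - X]mulr1 -(Cint_normal_pdf a s0) -CintZ// -CintB//; last first.
  exact: CintegrableZ.
pose H t := e / 2 * normal_pdf a s t +
  K * (4 * s ^+ 2 * Num.sqrt 2) * normal_pdf a (Num.sqrt 2 * s) t.
have iH1 : leb.-integrable setT (EFin \o (fun t => e / 2 * normal_pdf a s t)).
  by apply: integrable_mull; exact: integrable_normal_pdf.
have iH2 : leb.-integrable setT (EFin \o (fun t =>
    K * (4 * s ^+ 2 * Num.sqrt 2) * normal_pdf a (Num.sqrt 2 * s) t)).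
  by apply: integrable_mull; exact: integrable_normal_pdf.
apply: (@le_trans _ _ (\int[leb]_t H t)).
  apply: normc_Cint_le.
  - apply: CmeasurableD; first by apply: CmeasurableM => //; exact: Cmeasurable_normal_pdf.
    rewrite (_ : (fun x => _) = (fun t => (- F a) * (normal_pdf a s t)%:C)).
      by apply: CmeasurableM; [exact: Cmeasurable_cst|exact: Cmeasurable_normal_pdf].
    by apply/funext => t; rewrite mulNr.
  - exact: (integrableD measurableT iH1 iH2).
  - move=> t; rewrite -mulrBl normcM normc_normal_pdf.
    apply: (le_trans (ler_wpM2r (normal_pdf_ge0 _ _ _) (Ft t))).
    rewrite mulrDl lerD2l -[leLHS]mulrA -[leRHS]mulrA ler_wpM2l//.
    exact: sqr_normal_pdf_le.
rewrite /H RintegralD// !RintegralZl//; [|exact: integrable_normal_pdf..].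
rewrite /Rintegral !integral_normal_pdf /= !mulr1.
by rewrite [leRHS](splitr e) lerD2l.
Qed.

Lemma normal_peakM (s hbar : R) : 0 < s -> 0 < hbar ->
  normal_peak s * normal_peak (hbar / s) = (2 * pi * hbar)^-1.
Proof.
move=> s0 h0; rewrite /normal_peak -invfM -sqrtrM; last first.
  by rewrite mulrn_wge0// mulr_ge0 ?sqr_ge0 ?pi_ge0.
congr (_^-1).
rewrite (_ : s ^+ 2 * pi *+ 2 * ((hbar / s) ^+ 2 * pi *+ 2) = (2 * pi * hbar) ^+ 2); last first.
  by field; rewrite gt_eqF.
by rewrite sqrtr_sqr ger0_norm// !mulr_ge0 ?pi_ge0// ltW.
Qed.

(* Gaussian regularization: F is smoothed by a Gaussian, whose Fourier transform
   is at most a constant, so only a bound on the transform of F is used. *)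
Lemma fourier_inversion_le (F : R -> R[i]) (G : R -> R) (M a hbar : R) :
  0 < hbar ->
  Cmeasurable (F : measurableTypeR R -> R[i]) ->
  leb.-integrable setT (EFin \o G) ->
  (forall t, Normc.normc (F t) <= G t) ->
  (forall t, Normc.normc (F t) <= M) ->
  (forall e : R, 0 < e -> \forall t \near a, Normc.normc (F a - F t) < e) ->
  ((Normc.normc (F a))%:E <= ((2 * pi * hbar)^-1)%:E *
    \int[leb]_eta (Normc.normc (Cint leb (fun t => cexp_i (- (eta * t / hbar)) * F t)))%:E)%E.
Proof.
move=> h0 mF iG FG FM cF; set B := (_ * _)%E.
pose Fh eta := Cint leb (fun t => cexp_i (- (eta * t / hbar)) * F t).
have mFF : Cmeasurable (fun z : measurableTypeR R * measurableTypeR R =>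
    cexp_i (- (z.2 * z.1 / hbar)) * F z.1).
  apply: CmeasurableM.
    apply: Cmeasurable_cexp; apply: measurableT_comp => //.
    by apply: measurable_funM => //; exact: measurable_funM.
  exact: (Cmeasurable_comp (@measurable_fst _ _ _ _) mF).
(* A bound on the Gaussian averages of F that is uniform in the width s suffices, since these
   averages approximate F a. *)
suff main s : 0 < s ->
    ((Normc.normc (Cint leb (fun t => F t * (normal_pdf a s t)%:C)))%:E <= B)%E.
  apply/lee_addgt0Pr => e e0.
  have [s s0 hs] := normal_pdf_approx_id mF FM cF e0.
  apply: (@le_trans _ _
    ((Normc.normc (Cint leb (fun t => F t * (normal_pdf a s t)%:C)))%:E + e%:E)%E).
    rewrite -EFinD lee_fin; set c := Cint _ _ in hs *.
    rewrite -{1}(subrK c (F a)) (le_trans (normcD _ _))// addrC lerD2l.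
    by rewrite normcB.
  by rewrite leeD2r// main.
move=> s0; have sg0 : 0 < hbar / s by rewrite divr_gt0.
pose p := normal_pdf 0 (hbar / s).
(* The damping [p] has the dual width hbar / s and makes the double integral converge absolutely.
   Integrating in eta first yields the Gaussian average of F around a, integrating in t first yields
   the damped transform [Fh]. *)
pose FF (z : measurableTypeR R * measurableTypeR R) : R[i] :=
  cexp_i (- (z.2 * z.1 / hbar)) * F z.1 * (cexp_i (z.2 * a / hbar) * (p z.2)%:C).
have mW : Cmeasurable (fun eta : measurableTypeR R => cexp_i (eta * a / hbar) * (p eta)%:C).
  apply: CmeasurableM; last exact: Cmeasurable_normal_pdf.
  by apply: Cmeasurable_cexp; apply: measurable_funM => //; exact: measurable_funM.
have mFFF : Cmeasurable FF.
  apply: CmeasurableM => //.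
  exact: (Cmeasurable_comp (@measurable_snd _ _ _ _) mW).
have ip := integrable_normal_pdf 0 (hbar / s) : leb.-integrable setT (EFin \o p).
have FFG t eta : Normc.normc (FF (t, eta)) <= G t * p eta.
  by rewrite /FF !normcM !normc_cexp normc_normal_pdf !mul1r ler_wpM2r// normal_pdf_ge0.
have f1 := @Cint_fubini1 _ _ _ _ R leb leb FF G p mFFF iG ip FFG.
have f2 := @Cint_fubini2 _ _ _ _ R leb leb FF G p mFFF iG ip FFG.
have sE t : (normal_pdf a s t)%:C = (normal_peak s)%:C *
    Cint leb (fun eta => cexp_i (- ((t - a) / hbar) * eta) * (p eta)%:C).
  rewrite Cint_cexp_normal_pdf// mulr0 [cexp_i 0](_ : _ = 1); last by rewrite /cexp_i cos0 sin0.
  rewrite mul1r -rmorphM /= normal_pdf_gt0E//; congr (_ * expR _)%:C.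
  by field; rewrite !gt_eqF.
have -> : Cint leb (fun t => F t * (normal_pdf a s t)%:C) =
    (normal_peak s)%:C * Cint leb (fun eta => cexp_i (eta * a / hbar) * (p eta)%:C * Fh eta).
  rewrite (_ : Cint leb (fun eta => cexp_i _ * (p eta)%:C * Fh eta) =
    Cint (leb \x leb)%E FF); last first.
    rewrite f2; apply: eq_Cint => eta; rewrite /FF /=.
    rewrite /Fh -CintZ; last first.
      apply: (@Cint_dominated _ _ _ leb _ G) => //.
        exact: (Cmeasurable_comp (measurable_pair2 eta) mFF).
      by move=> t; rewrite normcM normc_cexp mul1r.
    by apply: eq_Cint => t; rewrite mulrC.
  rewrite f1.
  have pk0 : normal_peak s != 0 by rewrite gt_eqF// normal_peak_gt0// gt_eqF.
  rewrite [in RHS](@eq_Cint _ _ _ leb _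
    (fun t => ((normal_peak s)^-1)%:C * (F t * (normal_pdf a s t)%:C))).
    rewrite CintZ; last first.
      apply: (@Cint_dominated _ _ _ leb _ (fun t => M * normal_pdf a s t)).
      - by apply: CmeasurableM => //; exact: Cmeasurable_normal_pdf.
      - by apply: integrable_mull; exact: integrable_normal_pdf.
      - by move=> t; rewrite normcM normc_normal_pdf ler_wpM2r// normal_pdf_ge0.
    by rewrite mulrA -rmorphM /= divff// mul1r.
  move=> t; rewrite sE [F t * _]mulrCA [RHS]mulrA -rmorphM /= mulVf// mul1r.
  rewrite -CintZ; last first.
    apply: (@Cint_dominated _ _ _ leb _ p) => //.
      apply: CmeasurableM; last exact: Cmeasurable_normal_pdf.
      by apply: Cmeasurable_cexp; exact: measurable_funM.
    by move=> eta; rewrite normcM normc_cexp mul1r normc_normal_pdf.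
  apply: eq_Cint => eta; rewrite /FF /=.
  have -> : - ((t - a) / hbar) * eta = - (eta * t / hbar) + eta * a / hbar.
    by field; rewrite gt_eqF.
  by rewrite cexpD; ring.
have mFh : Cmeasurable (fun eta : measurableTypeR R =>
    cexp_i (eta * a / hbar) * (p eta)%:C * Fh eta).
  have mg := Cmeasurable_Cint2 mFFF iG ip FFG.
  rewrite (_ : (fun eta => _) = (fun y => Cint leb (fun x => FF (x, y)))) //.
  apply/funext => eta; rewrite /Fh -CintZ; last first.
    apply: (@Cint_dominated _ _ _ leb _ G) => //.
      exact: (Cmeasurable_comp (measurable_pair2 eta) mFF).
    by move=> t; rewrite normcM normc_cexp mul1r.
  by apply: eq_Cint => t; rewrite /FF /= mulrC.
have nE eta : Normc.normc (cexp_i (eta * a / hbar) * (p eta)%:C * Fh eta) =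
    p eta * Normc.normc (Fh eta).
  by rewrite !normcM normc_cexp mul1r normc_normal_pdf.
have p0 eta : p eta != 0.
  by rewrite /p normal_pdf_gt0E// mulf_neq0// ?gt_eqF ?expR_gt0// normal_peak_gt0// gt_eqF.
(* Fubini yields measurability only for the transform damped by [p]; dividing by the continuous
   positive [p] recovers the undamped modulus. *)
have mFn : measurable_fun setT (fun eta : measurableTypeR R => Normc.normc (Fh eta)).
  apply: (eq_measurable_fun (fun eta => (p eta)^-1 * (p eta * Normc.normc (Fh eta)))).
    by move=> eta _; rewrite mulKf.
  apply: measurable_funM.
    apply: continuous_measurable_fun => eta; apply: cvgV => //.
    exact: continuous_normal_pdf_gt0.
  exact: (eq_measurable_fun _ (fun eta _ => nE eta) (measurable_normc mFh)).
have FhG eta : p eta * Normc.normc (Fh eta) <= (\int[leb]_t G t) * p eta.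
  rewrite mulrC ler_wpM2r ?normal_pdf_ge0//; apply: normc_Cint_le => //.
    exact: (Cmeasurable_comp (measurable_pair2 eta) mFF).
  by move=> t; rewrite normcM normc_cexp mul1r.
have iH : leb.-integrable setT (EFin \o (fun eta => p eta * Normc.normc (Fh eta))).
  apply: (le_integrable measurableT _ _ (integrable_mull (\int[leb]_t G t) ip)).
    by apply/measurable_EFinP; apply: measurable_funM => //; exact: measurable_normal_pdf.
  move=> eta _; rewrite lee_fin (le_trans _ (ler_norm _))// ger0_norm//.
  by rewrite mulr_ge0 ?normc_ge0 ?normal_pdf_ge0.
rewrite normcM normc_real ger0_norm ?normal_peak_ge0//.
apply: (@le_trans _ _ ((normal_peak s)%:E * \int[leb]_eta ((p eta * Normc.normc (Fh eta))%:E))%E).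
  rewrite EFinM lee_wpmul2l ?lee_fin ?normal_peak_ge0//.
  have -> : (\int[leb]_eta (p eta * Normc.normc (Fh eta))%:E)%E =
      (\int[leb]_eta (p eta * Normc.normc (Fh eta)))%:E.
    by rewrite /Rintegral fineK//; exact: integrable_fin_num.
  rewrite lee_fin; apply: normc_Cint_le => // eta.
  by rewrite nE.
(* The two peaks multiply to 1/(2 pi hbar) for every s, and [p] is at most its peak: this is where
   the dependence on s disappears. *)
rewrite /B -(normal_peakM s0 h0) EFinM -muleA lee_wpmul2l ?lee_fin ?normal_peak_ge0//.
rewrite -ge0_integralZl//; last 3 first.
  exact/measurable_EFinP.
  by move=> eta _; rewrite lee_fin normc_ge0.
  by rewrite lee_fin normal_peak_ge0.
apply: ge0_le_integral => //.
- by move=> eta _; rewrite lee_fin mulr_ge0 ?normc_ge0 ?normal_pdf_ge0.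
- by apply/measurable_EFinP; apply: measurable_funM => //; exact: measurable_normal_pdf.
- by apply/measurable_EFinP; exact: measurable_funM.
- move=> eta _; rewrite lee_fin ler_wpM2r ?normc_ge0//.
  by rewrite normal_pdf_ub// gt_eqF.
Qed.

End inversion.

(** * Gaussian windows *)

Section windows.
Context (R : realType) (hbar : R) (q : nat -> R).
Hypothesis hbar_gt0 : 0 < hbar.
Hypothesis q_gt0 : forall j, 0 < q j.
Local Notation leb := (@lebesgue_measure R).

(** Serves both as prefactor of the transform and as value of the window at 0. Its square for n = 1
    is the constant of Fourier inversion. *)
Definition stft_cst n : R := (2 * pi * hbar) `^ (- (n%:R / 2)).

Definition gauss1 j (t : R) : R :=
  stft_cst 1 * expR (- ((2 * hbar)^-1 * (q j * t ^+ 2))).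

Definition gaussn n (x : 'rV[R]_n) : R :=
  stft_cst n * expR (- ((2 * hbar)^-1 * \sum_(j < n) q j * x 0 j ^+ 2)).

Lemma pihbar_gt0 : 0 < 2 * pi * hbar.
Proof. by rewrite !mulr_gt0// pi_gt0. Qed.

Lemma stft_cst_gt0 n : 0 < stft_cst n.
Proof. by rewrite powR_gt0// pihbar_gt0. Qed.

Lemma stft_cst0 : stft_cst 0 = 1.
Proof. by rewrite /stft_cst mul0r oppr0 powRr0. Qed.

Lemma stft_cstS n : stft_cst n.+1 = stft_cst n * stft_cst 1.
Proof.
rewrite /stft_cst -powRD; last by rewrite (gt_eqF pihbar_gt0) implybT.
by congr (_ `^ _); rewrite -natr1; ring.
Qed.

Lemma stft_cst1_sqr : stft_cst 1 * stft_cst 1 = (2 * pi * hbar)^-1.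
Proof.
rewrite /stft_cst -powRD; last by rewrite (gt_eqF pihbar_gt0) implybT.
rewrite -[RHS]powR_inv1; last by rewrite ltW// pihbar_gt0.
by congr (_ `^ _); field.
Qed.

(** The standard deviation of the window in coordinate j: its exponent q_j t^2 / (2 hbar) equals t^2
    / (2 sigma^2). *)
Definition gauss_sigma j : R := Num.sqrt (hbar / q j).

Lemma gauss_sigma_gt0 j : 0 < gauss_sigma j.
Proof. by rewrite sqrtr_gt0 divr_gt0. Qed.

Lemma gauss1E j a t : gauss1 j (t - a) =
  stft_cst 1 / normal_peak (gauss_sigma j) * normal_pdf a (gauss_sigma j) t.
Proof.
have s0 := gauss_sigma_gt0 j.
rewrite normal_pdf_gt0E// mulrA divfK ?gt_eqF ?normal_peak_gt0 ?gt_eqF//.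
rewrite /gauss1; congr (_ * expR _).
rewrite /gauss_sigma sqr_sqrtr ?ltW ?divr_gt0//.
by field; rewrite !gt_eqF.
Qed.

Lemma gauss1_ge0 j t : 0 <= gauss1 j t.
Proof. by rewrite mulr_ge0 ?expR_ge0// ltW// stft_cst_gt0. Qed.

Lemma gauss10 j : gauss1 j 0 = stft_cst 1.
Proof. by rewrite /gauss1 expr0n/= !mulr0 oppr0 expR0 mulr1. Qed.

Lemma gauss1_le j t : gauss1 j t <= stft_cst 1.
Proof.
rewrite /gauss1 ler_piMr ?(ltW (stft_cst_gt0 _))//.
rewrite -[leRHS]expR0 ler_expR oppr_le0.
apply: mulr_ge0; first by rewrite invr_ge0 mulr_ge0// ltW.
by apply: mulr_ge0; [exact: ltW|exact: sqr_ge0].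
Qed.

Lemma integrable_gauss1 j a : leb.-integrable setT (EFin \o (fun t => gauss1 j (t - a))).
Proof.
rewrite (_ : (fun t => _) = fun t => stft_cst 1 / normal_peak (gauss_sigma j) *
  normal_pdf a (gauss_sigma j) t); last by apply/funext => t; rewrite gauss1E.
by apply: integrable_mull; exact: integrable_normal_pdf.
Qed.

Lemma gaussn_ge0 n (x : 'rV[R]_n) : 0 <= gaussn x.
Proof. by rewrite mulr_ge0 ?expR_ge0// ltW// stft_cst_gt0. Qed.

Lemma snocB n (y x : 'rV[R]_n) (t a : R) :
  snoc_rV (y, t) - snoc_rV (x, a) = snoc_rV (y - x, t - a).
Proof.
apply/rowP => i; rewrite !mxE.
by case: unliftP => [j _|_] /=; rewrite ?mxE.
Qed.

Lemma sum_snoc n (F : nat -> R -> R) (x : 'rV[R]_n) (t : R) :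
  \sum_(j < n.+1) F j (snoc_rV (x, t) 0 j) = \sum_(j < n) F j (x 0 j) + F n t.
Proof.
rewrite big_ord_recr /= snoc_rV_max; congr (_ + _).
apply: eq_bigr => i _; congr F.
by rewrite widen_ord_lift_max snoc_rV_lift.
Qed.

Lemma gaussn_snoc n (x : 'rV[R]_n) (t : R) :
  gaussn (snoc_rV (x, t)) = gaussn x * gauss1 n t.
Proof.
rewrite /gaussn (sum_snoc (fun j z => q j * z ^+ 2)) mulrDr opprD expRD stft_cstS /gauss1.
by ring.
Qed.

Lemma dot_snoc n (x y : 'rV[R]_n) (s t : R) :
  dot (snoc_rV (x, s)) (snoc_rV (y, t)) = dot x y + s * t.
Proof.
rewrite /dot big_ord_recr /= !snoc_rV_max; congr (_ + _).
apply: eq_bigr => i _.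
by rewrite widen_ord_lift_max !snoc_rV_lift.
Qed.

Lemma continuous_gaussn n (x : 'rV[R]_n) : continuous (fun y : 'rV[R]_n => gaussn (y - x)).
Proof.
move=> y; rewrite /gaussn.
have cS : (\sum_(j < n) q j * (z - x) 0 j ^+ 2) @[z --> y] -->
    \sum_(j < n) q j * (y - x) 0 j ^+ 2.
  apply: (cvg_big (@add_continuous R)) => [|i _]; first exact: nbhs_filter.
  have h : (z - x) 0 i @[z --> y] --> (y - x) 0 i.
    rewrite mxE (_ : (fun z : 'rV[R]_n => _) = (fun z => z 0 i + (- x) 0 i)).
      exact: (cvgD (@coord_continuous R 1 n 0 i y) (cvg_cst _)).
    by apply/funext => z; rewrite mxE.
  exact: (cvgM (cvg_cst (q i)) (cvgM h h)).
have c2 := cvgN (cvgM (cvg_cst ((2 * hbar)^-1)) cS).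
have c3 : expR (- ((2 * hbar)^-1 * \sum_(j < n) q j * (z - x) 0 j ^+ 2)) @[z --> y] -->
    expR (- ((2 * hbar)^-1 * \sum_(j < n) q j * (y - x) 0 j ^+ 2)).
  apply: (cvg_comp _ expR); last exact: continuous_expR.
  exact: c2.
exact: (cvgM (cvg_cst _) c3).
Qed.

Lemma measurable_gaussn n (x : 'rV[R]_n) : measurable_fun setT (fun y : 'rV[R]_n => gaussn (y - x)).
Proof. by apply: continuous_measurable_rV; exact: continuous_gaussn. Qed.

Lemma integrable_gaussn n (x : 'rV[R]_n) :
  (lebesgue_rV R n).-integrable setT (EFin \o (fun y : 'rV[R]_n => gaussn (y - x))).
Proof.
elim: n x => [|n IH] x.
  have mg : measurable_fun setT (EFin \o (fun y : 'rV[R]_0 => gaussn (y - x))).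
    by apply/measurable_EFinP; exact: measurable_gaussn.
  apply/integrableP; split => //.
  rewrite integral_dirac//; last exact: measurableT_comp.
  by rewrite diracE mem_set// mul1e /= ltry.
rewrite -(snoc_init x); apply: integrable_snoc.
  by apply/measurable_EFinP; exact: measurable_gaussn.
apply: (@prod_dominated_integrable _ _ _ _ _ _ _
  (fun p => gaussn (snoc_rV p - snoc_rV (init_rV x, x 0 ord_max)))
  (fun y => gaussn (y - init_rV x)) (fun t => gauss1 n (t - x 0 ord_max))) => //.
- exact: (measurableT_comp (measurable_gaussn _) (@measurable_snoc_rV R n)).
- exact: integrable_gauss1.
- move=> y t; rewrite snocB gaussn_snoc ger0_norm; first exact: lexx.
  by apply: mulr_ge0; [exact: gaussn_ge0|exact: gauss1_ge0].
Qed.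

End windows.

(** * The short-time Fourier transform *)

Section complex_continuity.
Context (R : realType).

Lemma continuous_complex (T : topologicalType) (f : T -> R[i]) :
  continuous (fun x => complex.Re (f x)) -> continuous (fun x => complex.Im (f x)) ->
  continuous (f : T -> R[i]^o).
Proof.
move=> cRe cIm; apply/continuous_normcP => x e e0.
have e20 : 0 < e / 2 by rewrite divr_gt0.
have /cvgrPdist_lt/(_ _ e20) hRe := cRe x.
have /cvgrPdist_lt/(_ _ e20) hIm := cIm x.
near=> y.
apply: (le_lt_trans (normc_le_ReIm _)); rewrite (splitr e) ReD ImD ReN ImN.
by apply: ltrD; near: y.
Unshelve. all: by end_near. Qed.

Lemma continuous_Creal (T : topologicalType) (f : T -> R) :
  continuous f -> continuous ((fun x => (f x)%:C) : T -> R[i]^o).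
Proof. by move=> cf; apply: continuous_complex => //= x; exact: cvg_cst. Qed.

Lemma continuous_cexp (T : topologicalType) (f : T -> R) :
  continuous f -> continuous ((fun x => cexp_i (f x)) : T -> R[i]^o).
Proof.
move=> cf; apply: continuous_complex => /= x.
  by apply: (cvg_comp f (@cos R)); [exact: cf|exact: continuous_cos].
by apply: (cvg_comp f (@sin R)); [exact: cf|exact: continuous_sin].
Qed.

Lemma continuous_CM (T : topologicalType) (f g : T -> R[i]) :
  continuous (f : T -> R[i]^o) -> continuous (g : T -> R[i]^o) ->
  continuous ((fun x => f x * g x) : T -> R[i]^o).
Proof. by move=> cf cg x; exact: (cvgM (cf x) (cg x)). Qed.

Lemma continuous_CB (T : topologicalType) (f g : T -> R[i]) :
  continuous (f : T -> R[i]^o) -> continuous (g : T -> R[i]^o) ->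
  continuous ((fun x => f x - g x) : T -> R[i]^o).
Proof. by move=> cf cg x; exact: (cvgB (cf x) (cg x)). Qed.

Lemma cvg_normc_comp (T : topologicalType) (f : T -> R[i]) (u : nat -> T) x :
  continuous (f : T -> R[i]^o) -> u j @[j --> \oo] --> x ->
  Normc.normc (f (u j) - f x) @[j --> \oo] --> 0.
Proof.
move=> /continuous_normcP cf ux; apply/cvgr0Pnorm_lt => e e0.
have h : \forall j \near \oo, Normc.normc (f x - f (u j)) < e := ux _ (cf x e e0).
apply: filterS h => j.
by rewrite ger0_norm ?normc_ge0// normcB.
Qed.

Definition bcontinuous (T : topologicalType) (h : T -> R[i]) :=
  continuous (h : T -> R[i]^o) /\ exists M : R, forall x, Normc.normc (h x) <= M.

Lemma bcontinuousB (T : topologicalType) (h h' : T -> R[i]) :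
  bcontinuous h -> bcontinuous h' -> bcontinuous (fun x => h x - h' x).
Proof.
move=> [ch [M hM]] [ch' [M' hM']]; split; first exact: continuous_CB.
exists (M + M') => x; apply: (le_trans (normcD _ _)).
by rewrite normc_opp lerD.
Qed.

Lemma bcontinuous_comp (T U : topologicalType) (phi : T -> U) (h : U -> R[i]) :
  continuous phi -> bcontinuous h -> bcontinuous (h \o phi).
Proof.
move=> cphi [ch [M hM]]; split; last by exists M => x; exact: hM.
by move=> x; apply: (cvg_comp phi h); [exact: cphi|exact: ch].
Qed.

End complex_continuity.

Section short_time_fourier.
Context (R : realType) (hbar : R) (q : nat -> R).
Hypothesis hbar_gt0 : 0 < hbar.
Hypothesis q_gt0 : forall j, 0 < q j.
Local Notation leb := (@lebesgue_measure R).
Local Notation wn := (gaussn hbar q).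
Local Notation w1 := (gauss1 hbar q).
Local Notation scst := (stft_cst hbar).

Definition gstft n (h : 'rV[R]_n -> R[i]) (x xi : 'rV[R]_n) : R[i] :=
  stft hbar (@gauss_window R hbar q n) (distribution_of h) x xi.

Definition gnorm n (h : 'rV[R]_n -> R[i]) : \bar R :=
  Minf1_norm hbar (@gauss_window R hbar q n) (distribution_of h).

Definition gsup n (h : 'rV[R]_n -> R[i]) (xi : 'rV[R]_n) : \bar R :=
  ereal_sup [set (Normc.normc (gstft h x xi))%:E | x in [set: 'rV[R]_n]].

Definition stft_kernel n (h : 'rV[R]_n -> R[i]) (x xi y : 'rV[R]_n) : R[i] :=
  h y * (cexp_i (- (dot xi y / hbar)) * (wn (y - x))%:C).

Lemma gstftE n (h : 'rV[R]_n -> R[i]) x xi :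
  gstft h x xi = (scst n)%:C * Cint (lebesgue_rV R n) (stft_kernel h x xi).
Proof.
rewrite /gstft /stft; congr (_ * _); apply: eq_Cint => y; rewrite /stft_kernel.
by congr (_ * (_ * _)); apply: complex_eqP => //=; rewrite oppr0.
Qed.

Lemma gnormE n (h : 'rV[R]_n -> R[i]) : gnorm h = (\int[lebesgue_rV R n]_xi gsup h xi)%E.
Proof. by []. Qed.

Lemma continuous_dotr n (xi : 'rV[R]_n) : continuous (fun y : 'rV[R]_n => dot xi y).
Proof.
rewrite (_ : (fun y => _) = (fun y => dot y xi)); first exact: continuous_dot.
by apply/funext => z; apply: eq_bigr => i _; rewrite mulrC.
Qed.

Lemma continuous_stft_kernel n (h : 'rV[R]_n -> R[i]) x xi :
  bcontinuous h -> continuous (stft_kernel h x xi : 'rV[R]_n -> R[i]^o).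
Proof.
move=> [ch _].
apply: (@continuous_CM _ _ h (fun y => cexp_i (- (dot xi y / hbar)) * (wn (y - x))%:C) ch).
apply: (@continuous_CM _ _ (fun y => cexp_i (- (dot xi y / hbar))) (fun y => (wn (y - x))%:C)).
  apply: (@continuous_cexp _ _ (fun y : 'rV[R]_n => - (dot xi y / hbar))) => y.
  exact: (cvgN (cvgM (@continuous_dotr n xi y) (cvg_cst _))).
exact: (continuous_Creal (@continuous_gaussn R hbar q n x)).
Qed.

Lemma Cmeasurable_stft_kernel n (h : 'rV[R]_n -> R[i]) x xi :
  bcontinuous h -> Cmeasurable (stft_kernel h x xi).
Proof. by move=> bh; apply: continuous_Cmeasurable; exact: continuous_stft_kernel. Qed.

Lemma stft_kernel_le n (h : 'rV[R]_n -> R[i]) (M : R) x xi y :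
  (forall x, Normc.normc (h x) <= M) ->
  Normc.normc (stft_kernel h x xi y) <= M * wn (y - x).
Proof.
move=> hM; rewrite /stft_kernel !normcM normc_cexp mul1r normc_real.
by rewrite ger0_norm ?gaussn_ge0// ler_wpM2r// gaussn_ge0.
Qed.

Lemma integrable_stft_bound n (M : R) (x : 'rV[R]_n) :
  (lebesgue_rV R n).-integrable setT (EFin \o (fun y : 'rV[R]_n => M * wn (y - x))).
Proof. by apply: integrable_mull; exact: integrable_gaussn. Qed.

Lemma Cintegrable_stft_kernel n (h : 'rV[R]_n -> R[i]) x xi :
  bcontinuous h -> Cintegrable (lebesgue_rV R n) (stft_kernel h x xi).
Proof.
move=> bh; have [_ [M hM]] := bh.
apply: (Cint_dominated (Cmeasurable_stft_kernel x xi bh) (integrable_stft_bound M x)).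
by move=> y; exact: stft_kernel_le.
Qed.

Lemma gstftB n (h h' : 'rV[R]_n -> R[i]) x xi : bcontinuous h -> bcontinuous h' ->
  gstft (fun x => h x - h' x) x xi = gstft h x xi - gstft h' x xi.
Proof.
move=> bh bh'; rewrite !gstftE -mulrBr -CintB; try exact: Cintegrable_stft_kernel.
by congr (_ * _); apply: eq_Cint => y; rewrite /stft_kernel mulrBl.
Qed.

(** Applied to differences, this turns uniform convergence of functions into pointwise convergence
    of their transforms. *)
Lemma normc_gstft_le n (h : 'rV[R]_n -> R[i]) (M : R) x xi : bcontinuous h ->
  (forall x, Normc.normc (h x) <= M) ->
  Normc.normc (gstft h x xi) <= scst n * (M * \int[lebesgue_rV R n]_y wn (y - x)).
Proof.
move=> bh hM; rewrite gstftE normcM normc_real gtr0_norm ?stft_cst_gt0//.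
rewrite ler_pM2l ?stft_cst_gt0// -RintegralZl//; last exact: integrable_gaussn.
apply: normc_Cint_le; first exact: Cmeasurable_stft_kernel.
  exact: integrable_stft_bound.
by move=> y; exact: stft_kernel_le.
Qed.

Lemma continuous_gstft n (h : 'rV[R]_n -> R[i]) x : bcontinuous h ->
  continuous (gstft h x : 'rV[R]_n -> R[i]^o).
Proof.
move=> bh; have [_ [M hM]] := bh; apply/continuous_normcP => xi.
apply: seq_near_normc => u uxi.
have K0 := stft_cst_gt0 hbar_gt0 n.
rewrite (_ : (fun j => _) = (fun j => scst n * Normc.normc
   (Cint (lebesgue_rV R n) (stft_kernel h x (u j)) -
    Cint (lebesgue_rV R n) (stft_kernel h x xi)))); last first.
  by apply/funext => j; rewrite !gstftE -mulrBr normcM normc_real gtr0_norm.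
rewrite -(mulr0 (scst n)); apply: cvgMr.
apply: (Cint_dct _ (integrable_stft_bound M x)).
- by move=> j; exact: Cmeasurable_stft_kernel.
- by move=> j y; exact: stft_kernel_le.
- move=> y; apply: (@cvg_normc_comp _ _ (fun xi => stft_kernel h x xi y)) => //.
  apply: (@continuous_CM _ _ (fun=> h y)
    (fun xi => cexp_i (- (dot xi y / hbar)) * (wn (y - x))%:C)).
    exact: cst_continuous.
  apply: (@continuous_CM _ _ (fun xi => cexp_i (- (dot xi y / hbar))) (fun=> (wn (y - x))%:C)).
    apply: (@continuous_cexp _ _ (fun xi : 'rV[R]_n => - (dot xi y / hbar))) => z.
    exact: (cvgN (cvgM (@continuous_dot _ _ y z) (cvg_cst _))).
  exact: cst_continuous.
Qed.

Lemma gstft_le_gsup n (h : 'rV[R]_n -> R[i]) x xi :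
  ((Normc.normc (gstft h x xi))%:E <= gsup h xi)%E.
Proof. by apply: ereal_sup_ubound; exists x. Qed.

Lemma gsup_ge0 n (h : 'rV[R]_n -> R[i]) xi : (0 <= gsup h xi)%E.
Proof.
by apply: (le_trans _ (gstft_le_gsup h 0 xi)); rewrite lee_fin normc_ge0.
Qed.

Lemma gsup_le n (h : 'rV[R]_n -> R[i]) xi (B : \bar R) :
  (forall x, ((Normc.normc (gstft h x xi))%:E <= B)%E) -> (gsup h xi <= B)%E.
Proof. by move=> hB; apply: ge_ereal_sup => _ [x _ <-]; exact: hB. Qed.

(** The supremum runs over uncountably many x, so it is not covered by countable suprema. A supremum
    of functions continuous in xi is lower semicontinuous, hence measurable. *)
Lemma measurable_gsup n (h : 'rV[R]_n -> R[i]) : bcontinuous h ->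
  measurable_fun setT (gsup h).
Proof.
move=> bh; apply: lower_semicontinuous_measurable_rV => xi a.
move=> /ereal_sup_gt[_ [x _ <-]]; rewrite lte_fin => ax.
have e0 : 0 < Normc.normc (gstft h x xi) - a by rewrite subr_gt0.
have /continuous_normcP/(_ xi _ e0) := continuous_gstft (x := x) bh => nb.
eexists; first exact: nb.
move=> xi' /= h1; apply: lt_le_trans (gstft_le_gsup h x xi'); rewrite lte_fin.
rewrite -(ltrD2l (Normc.normc (gstft h x xi - gstft h x xi'))).
apply: (@lt_le_trans _ _ (Normc.normc (gstft h x xi))); first by rewrite -ltrBrDr.
by have := normcD (gstft h x xi - gstft h x xi') (gstft h x xi'); rewrite subrK.
Qed.

End short_time_fourier.

(** * Freezing and adding a coordinate *)

Section slices.
Context (R : realType) (hbar : R) (q : nat -> R).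
Hypothesis hbar_gt0 : 0 < hbar.
Hypothesis q_gt0 : forall j, 0 < q j.
Local Notation leb := (@lebesgue_measure R).
Local Notation wn := (gaussn hbar q).
Local Notation w1 := (gauss1 hbar q).
Local Notation scst := (stft_cst hbar).
Local Notation gstft := (gstft hbar q).
Local Notation gsup := (gsup hbar q).
Local Notation gnorm := (gnorm hbar q).
Local Notation kern := (stft_kernel hbar q).

Definition slice n (h : 'rV[R]_n.+1 -> R[i]) (a : R) : 'rV[R]_n -> R[i] :=
  fun x => h (snoc_rV (x, a)).

Lemma bcontinuous_slice n (h : 'rV[R]_n.+1 -> R[i]) a :
  bcontinuous h -> bcontinuous (slice h a).
Proof. by move=> bh; apply: bcontinuous_comp bh; exact: continuous_snoc_l. Qed.

Lemma normc_scst n : Normc.normc (scst n)%:C = scst n.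
Proof. by rewrite normc_real gtr0_norm; last exact: stft_cst_gt0. Qed.

Lemma kern_snoc n (h : 'rV[R]_n.+1 -> R[i]) x a xi eta y t :
  kern h (snoc_rV (x, a)) (snoc_rV (xi, eta)) (snoc_rV (y, t)) =
  kern (slice h t) x xi y * (cexp_i (- (eta * t / hbar)) * (w1 n (t - a))%:C).
Proof.
rewrite /stft_kernel /slice dot_snoc snocB (gaussn_snoc _ hbar_gt0).
rewrite mulrDl opprD cexpD rmorphM /=.
by ring.
Qed.

Lemma normc_kern_snoc_le n (h : 'rV[R]_n.+1 -> R[i]) (M : R) x a xi eta y t :
  (forall x, Normc.normc (h x) <= M) ->
  Normc.normc (kern h (snoc_rV (x, a)) (snoc_rV (xi, eta)) (snoc_rV (y, t))) <=
  (M * wn (y - x)) * w1 n (t - a).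
Proof.
move=> hM; rewrite -mulrA -(gaussn_snoc _ hbar_gt0) -snocB.
exact: stft_kernel_le.
Qed.

Section slice_estimate.
Context n (h : 'rV[R]_n.+1 -> R[i]) (a : R) (x xi : 'rV[R]_n).
Hypothesis bh : bcontinuous h.

(** The last frequency is set to 0, so that the phase in eta and t stays outside and the transform
    of [F] in t is that of h. The window factor in t - a remains inside: it makes [F] integrable and
    equals [scst 1] at t = a. *)
Let F (t : R) : R[i] := Cint (lebesgue_rV R n)
  (fun y => kern h (snoc_rV (x, a)) (snoc_rV (xi, 0)) (snoc_rV (y, t))).

Lemma slice_transform_at : (scst n)%:C * F a = (scst 1)%:C * gstft (slice h a) x xi.
Proof.
rewrite gstftE mulrCA; congr (_ * _); rewrite -CintZ; last first.
  by apply: Cintegrable_stft_kernel => //; exact: bcontinuous_slice.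
apply: eq_Cint => y; rewrite kern_snoc subrr gauss10 mul0r mul0r oppr0.
by rewrite [cexp_i 0](_ : _ = 1) ?mul1r 1?mulrC// /cexp_i cos0 sin0.
Qed.

Lemma Cmeasurable_slice_kern (t : R) : Cmeasurable
  (fun y => kern h (snoc_rV (x, a)) (snoc_rV (xi, 0)) (snoc_rV (y, t))).
Proof.
apply: continuous_Cmeasurable => y.
apply: (cvg_comp (fun y : 'rV[R]_n => snoc_rV (y, t))).
  exact: continuous_snoc_l.
exact: continuous_stft_kernel.
Qed.

Lemma Cintegrable_slice_kern (t : R) : Cintegrable (lebesgue_rV R n)
  (fun y => kern h (snoc_rV (x, a)) (snoc_rV (xi, 0)) (snoc_rV (y, t))).
Proof.
have [_ [M hM]] := bh.
apply: (Cint_dominated (Cmeasurable_slice_kern t)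
  (integrable_mull (w1 n (t - a)) (integrable_stft_bound hbar_gt0 q_gt0 M x))).
by move=> y; rewrite mulrC; exact: normc_kern_snoc_le.
Qed.

Lemma slice_transformE eta :
  gstft h (snoc_rV (x, a)) (snoc_rV (xi, eta)) =
  (scst n.+1)%:C * Cint leb (fun t => cexp_i (- (eta * t / hbar)) * F t).
Proof.
have [_ [M hM]] := bh.
rewrite gstftE; congr (_ * _).
rewrite (Cint_snoc2 (G1 := fun y => M * wn (y - x)) (G2 := fun t => w1 n (t - a))).
- apply: eq_Cint => t; rewrite /F -CintZ.
    apply: eq_Cint => y; rewrite !kern_snoc mul0r mul0r oppr0.
    rewrite [cexp_i 0](_ : _ = 1); last by rewrite /cexp_i cos0 sin0.
    by ring.
  exact: Cintegrable_slice_kern.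
- exact: Cmeasurable_stft_kernel.
- exact: integrable_stft_bound.
- exact: integrable_gauss1.
- by move=> y t; exact: normc_kern_snoc_le.
Qed.

(** [fourier_inversion_le] for [F] at t = a. The Gaussian factor in t gives its integrable majorant,
    dominated convergence its continuity at a. *)
Lemma normc_gstft_slice_le :
  ((Normc.normc (gstft (slice h a) x xi))%:E <=
   \int[leb]_eta gsup h (snoc_rV (xi, eta)))%E.
Proof.
have [_ [M hM]] := bh; have M0 : 0 <= M by exact: le_trans (normc_ge0 _) (hM 0).
have c0 n' : 0 < scst n' by exact: stft_cst_gt0.
pose W := \int[lebesgue_rV R n]_y (M * wn (y - x)).
have W0 : 0 <= W by apply: Rintegral_ge0 => y _; rewrite mulr_ge0 ?gaussn_ge0.
have mF : Cmeasurable (F : measurableTypeR R -> R[i]).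
  apply: (Cmeasurable_Cint_snoc (f := kern h (snoc_rV (x, a)) (snoc_rV (xi, 0)))
    (G1 := fun y => M * wn (y - x)) (G2 := fun t => w1 n (t - a))).
  - exact: Cmeasurable_stft_kernel.
  - exact: integrable_stft_bound.
  - exact: integrable_gauss1.
  - by move=> y t; exact: normc_kern_snoc_le.
have FG t : Normc.normc (F t) <= W * w1 n (t - a).
  rewrite mulrC -RintegralZl//; last exact: integrable_stft_bound.
  apply: normc_Cint_le.
  - exact: Cmeasurable_slice_kern.
  - by apply: integrable_mull; exact: integrable_stft_bound.
  - by move=> y; rewrite mulrC; exact: normc_kern_snoc_le.
have FM t : Normc.normc (F t) <= W * scst 1.
  by apply: (le_trans (FG t)); rewrite ler_wpM2l// gauss1_le.
have cF (e : R) : 0 < e -> \forall t \near a, Normc.normc (F a - F t) < e.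
  move: e; apply: seq_near_normc => u ua.
  apply: (@Cint_dct _ _ _ (lebesgue_rV R n)
    (fun j y => kern h (snoc_rV (x, a)) (snoc_rV (xi, 0)) (snoc_rV (y, u j))) _
    (fun y => scst 1 * (M * wn (y - x)))).
  - by move=> j; exact: Cmeasurable_slice_kern.
  - by apply: integrable_mull; exact: integrable_stft_bound.
  - move=> j y; apply: (le_trans (normc_kern_snoc_le _ _ _ _ _ _ hM)).
    rewrite mulrC; apply: ler_wpM2r; last exact: gauss1_le.
    by rewrite mulr_ge0 ?gaussn_ge0.
  - move=> y; apply: (@cvg_normc_comp _ _ (kern h (snoc_rV (x, a)) (snoc_rV (xi, 0)))).
      exact: continuous_stft_kernel.
    exact: (cvg_comp u (fun t : R => snoc_rV (y, t)) ua (@continuous_snoc_r R n y a)).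
have iG : leb.-integrable setT (EFin \o (fun t => W * w1 n (t - a))).
  by apply: integrable_mull; exact: integrable_gauss1.
have inv := fourier_inversion_le hbar_gt0 mF iG FG FM cF.
have e1 : Normc.normc (gstft (slice h a) x xi) = scst n / scst 1 * Normc.normc (F a).
  have e : scst n * Normc.normc (F a) = scst 1 * Normc.normc (gstft (slice h a) x xi).
    by rewrite -(normc_scst n) -(normc_scst 1) -!normcM slice_transform_at.
  by rewrite mulrAC e mulrC mulKf; last by rewrite gt_eqF.
have e2 eta : Normc.normc (Cint leb (fun t => cexp_i (- (eta * t / hbar)) * F t)) =
    (scst n.+1)^-1 * Normc.normc (gstft h (snoc_rV (x, a)) (snoc_rV (xi, eta))).
  by rewrite slice_transformE normcM normc_scst mulKf; last by rewrite gt_eqF.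
have msup : measurable_fun setT (fun eta : measurableTypeR R => gsup h (snoc_rV (xi, eta))).
  apply: (measurableT_comp (measurable_gsup hbar_gt0 q_gt0 bh)).
  exact: (measurableT_comp (@measurable_snoc_rV R n) (measurable_pair1 xi)).
have mstft : measurable_fun setT (fun eta : measurableTypeR R =>
    (scst n.+1)^-1 * Normc.normc (gstft h (snoc_rV (x, a)) (snoc_rV (xi, eta)))).
  apply: measurable_funM => //; apply: measurable_normc.
  apply: (Cmeasurable_comp (phi := fun eta : measurableTypeR R => snoc_rV (xi, eta))).
    exact: (measurableT_comp (@measurable_snoc_rV R n) (measurable_pair1 xi)).
  by apply: continuous_Cmeasurable; exact: continuous_gstft.
rewrite e1 EFinM; apply: (le_trans (lee_wpmul2l _ inv)).
  by rewrite lee_fin divr_ge0// ltW.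
(* The constants cancel: scst n / scst 1 from the value at a and (scst 1)^2 from inversion multiply
   to scst (n+1), against its inverse from the transform of h. *)
rewrite muleA -EFinM -(stft_cst1_sqr hbar_gt0).
have -> : scst n / scst 1 * (scst 1 * scst 1) = scst n.+1.
  by rewrite mulrA divfK ?gt_eqF// -stft_cstS.
apply: (@le_trans _ _ ((scst n.+1)%:E *
    \int[leb]_eta ((scst n.+1)^-1%:E * gsup h (snoc_rV (xi, eta))))%E).
  rewrite lee_wpmul2l ?lee_fin ?(ltW (c0 _))//.
  apply: ge0_le_integral => //.
  - by move=> eta _; rewrite lee_fin normc_ge0.
  - apply/measurable_EFinP.
    exact: (eq_measurable_fun _ (fun eta _ => esym (e2 eta)) mstft).
  - by apply: emeasurable_funM.
  - move=> eta _; rewrite e2 EFinM lee_wpmul2l ?lee_fin ?invr_ge0 ?(ltW (c0 _))//.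
    exact: gstft_le_gsup.
rewrite ge0_integralZl//; last 2 first.
  by move=> eta _; exact: gsup_ge0.
  by rewrite lee_fin invr_ge0 ltW.
by rewrite muleA -EFinM divff ?gt_eqF// mul1e.
Qed.

End slice_estimate.

Lemma measurable_gsup_snoc n (h : 'rV[R]_n.+1 -> R[i]) : bcontinuous h ->
  measurable_fun setT (fun p => gsup h (@snoc_rV R n p)).
Proof.
move=> bh; apply: (measurableT_comp (measurable_gsup hbar_gt0 q_gt0 bh)).
exact: measurable_snoc_rV.
Qed.

(** The bound of [normc_gstft_slice_le] is free of x, so it survives the supremum over x; Tonelli
    then joins the integrals in xi and eta. *)
Lemma gnorm_slice_le n (h : 'rV[R]_n.+1 -> R[i]) a : bcontinuous h ->
  (gnorm (slice h a) <= gnorm h)%E.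
Proof.
move=> bh; rewrite !gnormE ge0_integral_snoc_iter; last 2 first.
  exact: measurable_gsup.
  by move=> xi; exact: gsup_ge0.
apply: ge0_le_integral => //.
- by move=> xi _; exact: gsup_ge0.
- by apply: measurable_gsup => //; exact: bcontinuous_slice.
- apply: (@measurable_fun_fubini_tonelli_F _ _ _ _ _ leb (fun p => gsup h (@snoc_rV R n p))).
    exact: measurable_gsup_snoc.
  by move=> p; exact: gsup_ge0.
- by move=> xi _; apply: gsup_le => x; exact: normc_gstft_slice_le.
Qed.

Lemma normc_le_gnorm n (h : 'rV[R]_n -> R[i]) x : bcontinuous h ->
  ((Normc.normc (h x))%:E <= gnorm h)%E.
Proof.
elim: n h x => [|n IH] h x bh.
  (* On R^0 the measure is a Dirac mass and both normalizations are 1, so the transform at the only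
     point has modulus |h|. *)
  rewrite gnormE integral_dirac//; last exact: measurable_gsup.
  rewrite diracE mem_set// mul1e.
  apply: le_trans (gstft_le_gsup _ _ h x 0); rewrite lee_fin.
  rewrite gstftE stft_cst0 mul1r.
  have -> : Cint (lebesgue_rV R 0) (kern h x 0) = kern h x 0 0.
    have [mRe mIm] := Cmeasurable_stft_kernel hbar q x 0 bh.
    apply: complex_eqP; rewrite /= /Rintegral integral_dirac// ?diracE ?mem_set// ?mul1e//;
    exact/measurable_EFinP.
  rewrite /stft_kernel !normcM normc_cexp normc_real.
  have -> : x = 0 by apply/rowP; case.
  by rewrite /gaussn stft_cst0 big_ord0 mulr0 oppr0 expR0 mulr1 normr1 !mulr1.
rewrite -(snoc_init x).
apply: (le_trans _ (gnorm_slice_le (x 0 ord_max) bh)).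
apply: (IH (slice h (x 0 ord_max))); exact: bcontinuous_slice.
Qed.

Definition lift_rV n (h : 'rV[R]_n -> R[i]) : 'rV[R]_n.+1 -> R[i] := h \o @init_rV R n.

Lemma bcontinuous_lift n (h : 'rV[R]_n -> R[i]) : bcontinuous h -> bcontinuous (lift_rV h).
Proof. by apply: bcontinuous_comp; exact: continuous_init. Qed.

(** One factor [scst 1] belongs to the transform, another to the window; their product 1/(2 pi hbar)
    is the product of the peaks of widths sigma and hbar / sigma. What remains is a probability
    density, and the translation by a only contributes a phase. *)
Lemma normc_Cint_gauss1 n a eta :
  scst 1 * Normc.normc (Cint leb (fun t => cexp_i (- (eta * t / hbar)) * (w1 n (t - a))%:C)) =
  normal_pdf 0 (hbar / gauss_sigma hbar q n) eta.
Proof.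
have s0 : 0 < gauss_sigma hbar q n by exact: gauss_sigma_gt0.
set s := gauss_sigma hbar q n in s0 *.
have c0 : 0 < scst 1 by exact: stft_cst_gt0.
have p0 : 0 < normal_peak s by rewrite normal_peak_gt0// gt_eqF.
have -> : Cint leb (fun t => cexp_i (- (eta * t / hbar)) * (w1 n (t - a))%:C) =
    (scst 1 / normal_peak s)%:C * (cexp_i (- (eta / hbar) * a) *
      (expR (- (s ^+ 2 * (- (eta / hbar)) ^+ 2 / 2)))%:C).
  rewrite -Cint_cexp_normal_pdf// -CintZ; last first.
    apply: (Cint_dominated (mu := leb) _ (integrable_normal_pdf a s)).
      apply: CmeasurableM; last exact: Cmeasurable_normal_pdf.
      by apply: Cmeasurable_cexp; exact: measurable_funM.
    by move=> t; rewrite normcM normc_cexp mul1r normc_normal_pdf.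
  apply: eq_Cint => t; rewrite gauss1E// rmorphM /=.
  have -> : - (eta * t / hbar) = - (eta / hbar) * t by ring.
  by ring.
rewrite !normcM normc_cexp !normc_real mul1r.
rewrite ger0_norm; last by rewrite divr_ge0// ltW.
rewrite ger0_norm ?expR_ge0// mulrA mulrA stft_cst1_sqr// -(normal_peakM s0)//.
rewrite [_ * normal_peak (hbar / s)]mulrC mulfK ?gt_eqF//.
rewrite normal_pdf_gt0E ?divr_gt0//; congr (_ * expR _).
by field; rewrite !gt_eqF.
Qed.

Lemma gstft_lift n (h : 'rV[R]_n -> R[i]) x a xi eta : bcontinuous h ->
  Normc.normc (gstft (lift_rV h) (snoc_rV (x, a)) (snoc_rV (xi, eta))) =
  Normc.normc (gstft h x xi) * normal_pdf 0 (hbar / gauss_sigma hbar q n) eta.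
Proof.
move=> bh; have bl := bcontinuous_lift bh; have [_ [M hM]] := bh.
have sl t : slice (lift_rV h) t = h.
  by apply/funext => y; rewrite /slice /lift_rV /= init_snoc.
rewrite !gstftE stft_cstS//.
have -> : Cint (lebesgue_rV R n.+1) (kern (lift_rV h) (snoc_rV (x, a)) (snoc_rV (xi, eta))) =
    Cint (lebesgue_rV R n) (kern h x xi) *
    Cint leb (fun t => cexp_i (- (eta * t / hbar)) * (w1 n (t - a))%:C).
  rewrite (Cint_snoc2 (G1 := fun y => M * wn (y - x)) (G2 := fun t => w1 n (t - a))).
  - rewrite -CintZ; last first.
      apply: (@Cint_dominated _ _ _ leb _ (fun t => w1 n (t - a))).
      + apply: CmeasurableM.
          apply: Cmeasurable_cexp; apply: measurableT_comp => //.
          by apply: measurable_funM => //; exact: measurable_funM.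
        apply: Cmeasurable_real.
        have /integrableP[/measurable_EFinP + _] := integrable_gauss1 hbar_gt0 q_gt0 n a.
        exact.
      + exact: integrable_gauss1.
      + by move=> t; rewrite normcM normc_cexp mul1r normc_real ger0_norm// gauss1_ge0.
    apply: eq_Cint => t; rewrite mulrC -CintZ; last exact: Cintegrable_stft_kernel.
    by apply: eq_Cint => y; rewrite kern_snoc sl mulrC.
  - exact: Cmeasurable_stft_kernel.
  - exact: integrable_stft_bound.
  - exact: integrable_gauss1.
  - by move=> y t; apply: normc_kern_snoc_le => z; exact: hM.
rewrite !normcM normc_scst -(normc_Cint_gauss1 n a eta).
rewrite [Normc.normc (_ * _)%:C]normc_real ger0_norm; last first.
  by rewrite mulr_ge0// ltW// stft_cst_gt0.
by ring.
Qed.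

(** The density in eta from [gstft_lift] does not depend on the point (x, a), so it leaves the
    supremum and integrates to 1. *)
Lemma gnorm_lift_le n (h : 'rV[R]_n -> R[i]) : bcontinuous h ->
  (gnorm (lift_rV h) <= gnorm h)%E.
Proof.
move=> bh; have bl := bcontinuous_lift bh.
rewrite !gnormE ge0_integral_snoc_iter; last 2 first.
  exact: measurable_gsup.
  by move=> xi; exact: gsup_ge0.
apply: ge0_le_integral => //.
- by move=> xi _; apply: integral_ge0 => eta _; exact: gsup_ge0.
- apply: (@measurable_fun_fubini_tonelli_F _ _ _ _ _ leb
    (fun p => gsup (lift_rV h) (@snoc_rV R n p))).
    exact: measurable_gsup_snoc.
  by move=> p; exact: gsup_ge0.
- exact: measurable_gsup.
move=> xi _; pose g := normal_pdf (0 : R) (hbar / gauss_sigma hbar q n).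
apply: (@le_trans _ _ (\int[leb]_eta (gsup h xi * (g eta)%:E))%E).
  apply: ge0_le_integral => //.
  - by move=> eta _; exact: gsup_ge0.
  - apply: (measurableT_comp (measurable_gsup_snoc bl)); exact: measurable_pair1.
  - by apply: emeasurable_funM => //; apply/measurable_EFinP; exact: measurable_normal_pdf.
  move=> eta _; apply: gsup_le => z.
  rewrite -(snoc_init z) gstft_lift// EFinM lee_wpmul2r ?lee_fin ?normal_pdf_ge0//.
  exact: gstft_le_gsup.
rewrite ge0_integralZl//.
- by rewrite integral_normal_pdf mule1.
- by apply/measurable_EFinP; exact: measurable_normal_pdf.
- by move=> eta _; rewrite lee_fin normal_pdf_ge0.
- exact: gsup_ge0.
Qed.

End slices.

(** * Bounded continuous functions as tempered distributions *)

Section ereal_cvg0.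
Context (R : realType).

Lemma ecvg0_near (u : nat -> \bar R) : u j @[j --> \oo] --> 0%E ->
  forall e : R, 0 < e -> \forall j \near \oo, (u j < e%:E)%E.
Proof.
move=> /fine_cvgP[fin /cvgrPdist_lt cu] e e0; have := cu e e0.
apply: filterS2 fin => j fj /=; rewrite sub0r normrN => h.
by rewrite -(fineK fj) lte_fin (le_lt_trans (ler_norm _)).
Qed.

Lemma near_ecvg0 (u : nat -> \bar R) : (forall j, (0 <= u j)%E) ->
  (forall e : R, 0 < e -> \forall j \near \oo, (u j <= e%:E)%E) ->
  u j @[j --> \oo] --> 0%E.
Proof.
move=> u0 hu; apply/fine_cvgP; split.
  move: (hu 1 ltr01); apply: filterS => j h.
  by rewrite ge0_fin_numE//; exact: le_lt_trans h (ltry _).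
apply/cvgrPdist_le => e e0; move: (hu e e0); apply: filterS => j h.
rewrite /= sub0r normrN ger0_norm ?fine_ge0// -lee_fin fineK// ge0_fin_numE//.
exact: le_lt_trans h (ltry _).
Qed.

End ereal_cvg0.

Section temperedness.
Context (R : realType).
Local Notation leb := (@lebesgue_measure R).

(** An integrable majorant for Schwartz functions; the product form allows integration one
    coordinate at a time, each factor having integral pi. *)
Definition decay n (x : 'rV[R]_n) : R := \prod_(i < n) (1 + x 0 i ^+ 2)^-1.

Lemma decay_ge0 n (x : 'rV[R]_n) : 0 <= decay x.
Proof. by apply: prodr_ge0 => i _; rewrite invr_ge0 addr_ge0// sqr_ge0. Qed.

Lemma decay_snoc n (x : 'rV[R]_n) t : decay (snoc_rV (x, t)) = decay x * (1 + t ^+ 2)^-1.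
Proof.
rewrite /decay big_ord_recr /= snoc_rV_max; congr (_ * _); apply: eq_bigr => i _.
by rewrite widen_ord_lift_max snoc_rV_lift.
Qed.

Lemma measurable_inv1Dsqr : measurable_fun setT (fun t : R => (1 + t ^+ 2)^-1).
Proof.
apply: continuous_measurable_fun; exact: continuous_oneDsqrV.
Qed.

Lemma integrable_inv1Dsqr : leb.-integrable setT (EFin \o (fun t : R => (1 + t ^+ 2)^-1)).
Proof.
apply/integrableP; split; first by apply/measurable_EFinP; exact: measurable_inv1Dsqr.
have -> : (\int[leb]_x `|(EFin \o (fun t : R => (1 + t ^+ 2)^-1)%R) x| =
    \int[leb]_t ((oneDsqr t)^-1)%:E)%E.
  apply: eq_integral => t _.
  by rewrite /= ger0_norm// invr_ge0 addr_ge0 ?sqr_ge0.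
rewrite (@ge0_symfun_integralT R (fun t : R => (oneDsqr t)^-1)).
- by rewrite -set_itvcy integral0y_oneDsqr -EFinM ltry.
- by move=> t; rewrite invr_ge0 addr_ge0 ?sqr_ge0.
- exact: continuous_oneDsqrV.
- by move=> t; rewrite /= /oneDsqr sqrrN.
Qed.

Lemma measurable_decay n : measurable_fun setT (@decay n).
Proof.
apply: measurable_prod => i _.
exact: (measurableT_comp measurable_inv1Dsqr (@measurable_rV_coord R n i)).
Qed.

Lemma integrable_decay n : (lebesgue_rV R n).-integrable setT (EFin \o @decay n).
Proof.
have md n' : measurable_fun setT (EFin \o @decay n').
  by apply/measurable_EFinP; exact: measurable_decay.
elim: n => [|n IH].
  apply/integrableP; split; first exact: md.
  rewrite integral_dirac//; last exact: (measurableT_comp _ (md 0%N)).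
  by rewrite diracE mem_set// mul1e /= ltry.
apply: integrable_snoc; first exact: md.
apply: (@prod_dominated_integrable _ _ _ _ _ _ _ (fun p => decay (snoc_rV p))
  (@decay n) (fun t => (1 + t ^+ 2)^-1)) => //.
- exact: (measurableT_comp (@measurable_decay _) (@measurable_snoc_rV R n)).
- exact: integrable_inv1Dsqr.
- by move=> y t; rewrite decay_snoc ger0_norm// mulr_ge0 ?decay_ge0// invr_ge0 addr_ge0 ?sqr_ge0.
Qed.

(* Exponents of the monomials in the expansion of \prod_i (1 + x_i ^+ 2). *)
Definition double_on n (A : {set 'I_n}) (i : 'I_n) : nat := if i \in A then 0 else 2.

(** Expanding the product of the 1 + x_i^2 over subsets of indices gives one monomial per subset,
    each controlled by one seminorm. The constant is thus 2^n C, written as a sum. *)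
Lemma schwartz_decay n (f : 'rV[R]_n -> R[i]) (C : R) x :
  (forall A : {set 'I_n}, (seminorm (double_on A) [::] f <= C%:E)%E) ->
  Normc.normc (f x) <= (\sum_(A : {set 'I_n}) C) * decay x.
Proof.
move=> hC.
have P0 : 0 < \prod_(i < n) (1 + x 0 i ^+ 2).
  by apply: prodr_gt0 => i _; rewrite ltr_pwDl// sqr_ge0.
rewrite /decay prodfV ler_pdivlMr// mulrC.
rewrite (@bigA_distr _ 0 1 *%R +%R) mulr_suml; apply: ler_sum => A _.
have : ((`|\prod_(i < n) x 0 i ^+ double_on A i| * Normc.normc (f x))%:E <= C%:E)%E.
  by apply: le_trans (hC A); apply: ereal_sup_ubound; exists x.
rewrite lee_fin; apply: le_trans; rewrite ler_wpM2r ?normc_ge0//.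
apply: le_trans (ler_norm _); rewrite le_eqVlt; apply/orP; left; apply/eqP.
by apply: eq_bigr => i _; rewrite /double_on; case: ifP.
Qed.

Lemma seminorm_ge0 n a s (f : 'rV[R]_n -> R[i]) : (0 <= seminorm a s f)%E.
Proof.
apply: (@le_trans _ _ ((`|\prod_(i < n) (0 : 'rV[R]_n) 0 i ^+ a i| *
  Normc.normc (iter_partial s f 0))%:E)).
  by rewrite lee_fin mulr_ge0 ?normc_ge0.
by apply: ereal_sup_ubound; exists 0.
Qed.

Lemma schwartz_decay_ex n (f : 'rV[R]_n -> R[i]) : schwartz f ->
  exists D : R, forall x, Normc.normc (f x) <= D * decay x.
Proof.
move=> [_ sf].
pose C := \sum_(A : {set 'I_n}) fine (seminorm (double_on A) [::] f).
have s0 A : 0 <= fine (seminorm (double_on A) [::] f) by rewrite fine_ge0// seminorm_ge0.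
exists (\sum_(A : {set 'I_n}) C) => x; apply: schwartz_decay => A.
rewrite -[leLHS]fineK ?ge0_fin_numE ?seminorm_ge0// lee_fin /C (bigD1 A)//= lerDl.
by apply: sumr_ge0 => B _; exact: s0.
Qed.

Lemma tempered_bcontinuous n (h : 'rV[R]_n -> R[i]) :
  bcontinuous h -> tempered (distribution_of h).
Proof.
move=> [ch [M hM]]; have M0 : 0 <= M by exact: le_trans (normc_ge0 _) (hM 0).
have mh := continuous_Cmeasurable ch.
have ms phi : schwartz phi -> Cmeasurable (fun y : 'rV[R]_n => h y * phi y).
  move=> sp; apply: CmeasurableM => //; apply: continuous_Cmeasurable.
  by have [+ _] := sp => /(_ [::])[].
have is_ phi : schwartz phi -> Cintegrable (lebesgue_rV R n) (fun y => h y * phi y).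
  move=> sp; have [D hD] := schwartz_decay_ex sp.
  apply: (Cint_dominated (ms _ sp) (integrable_mull (M * D) (integrable_decay n))) => y.
  by rewrite normcM -mulrA ler_pM ?normc_ge0.
split=> [c phi psi sphi spsi|phi_ phi sphi_ sphi cphi].
  rewrite /distribution_of -!/(Cint (lebesgue_rV R n) _).
  transitivity (Cint (lebesgue_rV R n) (fun y => c * (h y * phi y) + h y * psi y)).
    by apply: eq_Cint => y; ring.
  by rewrite CintD ?CintZ//; [exact: is_|exact: CintegrableZ (is_ _ _)|exact: is_].
apply/cvg_normcP => e e0.
set W := \int[lebesgue_rV R n]_y decay y.
have W0 : 0 <= W by apply: Rintegral_ge0 => y _; exact: decay_ge0.
(* The sup bound of h, the number of monomials and the integral of [decay]; below, K + 1 guards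
   against K = 0. *)
pose K := M * (\sum_(A : {set 'I_n}) 1) * W.
have K0 : 0 <= K by rewrite !mulr_ge0// sumr_ge0.
have d0 : 0 < e / (K + 1) by rewrite divr_gt0// ltr_wpDl.
(* Only finitely many seminorms enter, so they become small simultaneously. *)
have /filter_forall hA : forall A : {set 'I_n}, \forall j \near \oo,
    (seminorm (double_on A) [::] (fun x => (phi_ j x - phi x)%R) <= (e / (K + 1))%:E)%E.
  move=> A; have := ecvg0_near (cphi (double_on A) [::]) d0.
  by apply: filterS => j; exact: ltW.
move: hA; apply: filterS => j hA.
rewrite /distribution_of -!/(Cint (lebesgue_rV R n) _) normcB -CintB; [|exact: is_..].
apply: (@le_lt_trans _ _ (\int[lebesgue_rV R n]_y
    (M * ((\sum_(A : {set 'I_n}) (e / (K + 1))) * decay y)))).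
  apply: normc_Cint_le.
  - rewrite (_ : (fun x => _) = (fun y => h y * phi_ j y + (-1) * (h y * phi y))).
      apply: CmeasurableD; first exact: ms.
      by apply: CmeasurableM; [exact: Cmeasurable_cst|exact: ms].
    by apply/funext => y; rewrite mulN1r.
  - by apply: integrable_mull; apply: integrable_mull; exact: integrable_decay.
  - move=> y; rewrite -mulrBr normcM ler_pM ?normc_ge0//.
    exact: (@schwartz_decay _ (fun y => phi_ j y - phi y)).
rewrite RintegralZl//; last by apply: integrable_mull; exact: integrable_decay.
rewrite RintegralZl//; last exact: integrable_decay.
rewrite (_ : _ * _ = K * (e / (K + 1))); last first.
  rewrite /K [in LHS](eq_bigr (fun=> 1 * (e / (K + 1)))); last by move=> A _; rewrite mul1r.
  by rewrite -mulr_suml -/W; ring.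
by rewrite mulrA ltr_pdivrMr ?ltr_wpDl// mulrC ltr_pM2l// ltrDl.
Qed.

End temperedness.

(** * Completeness *)

Lemma le_limn_einf (R : realType) (u v : nat -> \bar R) :
  (forall j, (u j <= v j)%E) -> (limn_einf u <= limn_einf v)%E.
Proof.
move=> uv; rewrite !limn_einf_lim; apply: lee_lim; [exact: is_cvg_einfs..|].
apply: nearW => n; apply: le_ereal_inf_tmp => _ [k nk <-].
by apply: le_trans (uv k); apply: ereal_inf_lbound; exists k.
Qed.

Lemma ler_dist_normc (R : realType) (a b : R[i]) :
  `|Normc.normc a - Normc.normc b| <= Normc.normc (a - b).
Proof.
have h1 := normcD (a - b) b; have h2 := normcD (b - a) a.
rewrite !subrK in h1 h2; rewrite (normcB b a) in h2.
by rewrite ler_norml lerBlDr h1 andbT lerNl opprB lerBlDr.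
Qed.

Lemma normc_triangle (R : realType) (b a c : R[i]) :
  Normc.normc (a - c) <= Normc.normc (a - b) + Normc.normc (b - c).
Proof. by rewrite -[a - c](subrKA b); exact: normcD. Qed.

Section completeness.
Context (R : realType) (hbar : R) (q : nat -> R).
Hypothesis hbar_gt0 : 0 < hbar.
Hypothesis q_gt0 : forall j, 0 < q j.
Local Notation gstft := (gstft hbar q).
Local Notation gsup := (gsup hbar q).
Local Notation gnorm := (gnorm hbar q).
Local Notation window n := (@gauss_window R hbar q n).

Lemma Minf1_funP n (h : 'rV[R]_n -> R[i]) :
  Minf1_fun hbar (window n) h <-> bcontinuous h /\ (gnorm h < +oo)%E.
Proof.
split=> [[ch bh [_ hn]]|[bh hn]]; first by split.
by have [ch Mh] := bh; split => //; split => //; exact: tempered_bcontinuous.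
Qed.

Lemma gnorm_ge0 n (h : 'rV[R]_n -> R[i]) : (0 <= gnorm h)%E.
Proof. by apply: integral_ge0 => xi _; exact: gsup_ge0. Qed.

Lemma gnormB_le n (h h' : 'rV[R]_n -> R[i]) : bcontinuous h -> bcontinuous h' ->
  (gnorm (fun x => h x - h' x)%R <= gnorm h + gnorm h')%E.
Proof.
move=> bh bh'; rewrite !gnormE -ge0_integralD//; first last.
- exact: measurable_gsup.
- by move=> xi _; exact: gsup_ge0.
- exact: measurable_gsup.
- by move=> xi _; exact: gsup_ge0.
apply: ge0_le_integral => //.
- by move=> xi _; exact: gsup_ge0.
- by apply: measurable_gsup => //; exact: bcontinuousB.
- by apply: emeasurable_funD; exact: measurable_gsup.
move=> xi _; apply: gsup_le => x; rewrite gstftB//.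
apply: (@le_trans _ _ ((Normc.normc (gstft h x xi))%:E + (Normc.normc (gstft h' x xi))%:E)%E).
  by rewrite -EFinD lee_fin (le_trans (normcD _ _))// normc_opp.
by apply: leeD; exact: gstft_le_gsup.
Qed.

(** Lower semicontinuity of the norm. The transforms converge pointwise by [normc_gstft_le], so the
    supremum for h is at most the lower limit of those for [h_ j]; Fatou's lemma integrates this. *)
Lemma gnorm_le_uniform_limit n (h_ : nat -> 'rV[R]_n -> R[i]) (h : 'rV[R]_n -> R[i])
    (B : \bar R) :
  (forall j, bcontinuous (h_ j)) -> bcontinuous h ->
  (forall e : R, 0 < e ->
     \forall j \near \oo, forall x, Normc.normc (h_ j x - h x) <= e) ->
  (forall j, (gnorm (h_ j) <= B)%E) -> (gnorm h <= B)%E.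
Proof.
move=> bh_ bh cvh hB.
apply: (@le_trans _ _ (\int[lebesgue_rV R n]_xi limn_einf (fun j => gsup (h_ j) xi))%E).
  rewrite gnormE; apply: ge0_le_integral => //.
  - by move=> xi _; exact: gsup_ge0.
  - exact: measurable_gsup.
  - apply: measurableT_comp => //; apply: measurable_fun_limn_esup => j.
    by apply: measurableT_comp => //; exact: measurable_gsup.
  move=> xi _; apply: gsup_le => x.
  have cV : (Normc.normc (gstft (h_ j) x xi))%:E @[j --> \oo] --> (Normc.normc (gstft h x xi))%:E.
    apply: cvg_EFin; first exact: nearW.
    pose K := stft_cst hbar n * \int[lebesgue_rV R n]_y gaussn hbar q (y - x).
    have K0 : 0 <= K.
      rewrite mulr_ge0 ?(ltW (stft_cst_gt0 hbar_gt0 n))//.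
      by apply: Rintegral_ge0 => y _; exact: gaussn_ge0.
    apply/cvgrPdist_le => e e0.
    have d0 : 0 < e / (K + 1) by rewrite divr_gt0// ltr_wpDl.
    move: (cvh _ d0); apply: filterS => j hj.
    have hV : Normc.normc (gstft (h_ j) x xi - gstft h x xi) <= e.
      rewrite -gstftB//; apply: (le_trans (normc_gstft_le hbar_gt0 q_gt0 x xi _ hj)).
        exact: bcontinuousB.
      rewrite mulrCA -/K mulrC mulrA ler_pdivrMr ?ltr_wpDl//.
      by rewrite mulrC ler_pM2l// lerDl.
    by apply: (le_trans (ler_dist_normc _ _)); rewrite normcB.
  rewrite -(cvg_limn_einf_sup cV).1.
  by apply: le_limn_einf => j; exact: gstft_le_gsup.
apply: le_trans (fatou _ _ _ _) _ => //.
- by move=> j; exact: measurable_gsup.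
- by move=> j xi _; exact: gsup_ge0.
rewrite -[leRHS](cvg_limn_einf_sup (cvg_cst B : (fun _ : nat => B) j @[j --> \oo] --> B)).1.
by apply: le_limn_einf => j; exact: hB.
Qed.

Lemma uniform_cauchy_limit (T : topologicalType) (h_ : nat -> T -> R[i]) :
  (forall j, bcontinuous (h_ j)) ->
  (forall e : R, 0 < e -> exists N : nat, forall i j, (N <= i)%N -> (N <= j)%N ->
     forall x, Normc.normc (h_ i x - h_ j x) <= e) ->
  exists2 h, bcontinuous h &
    forall e : R, 0 < e -> \forall j \near \oo, forall x, Normc.normc (h_ j x - h x) <= e.
Proof.
move=> bh_ ch.
have cRe x : cvgn (fun j => complex.Re (h_ j x)).
  apply: cauchy_cvg; apply: cauchy_exP => e e0.
  have [N hN] := ch _ (divr_gt0 e0 (@ltr0Sn R 1)).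
  exists (complex.Re (h_ N x)); exists N => // j /= Nj.
  rewrite /ball /= -ReN -ReD (le_lt_trans (ler_normRe _))//.
  by rewrite (le_lt_trans (hN N j (leqnn N) Nj x))// ltr_pdivrMr// ltr_pMr// ltr1n.
have cIm x : cvgn (fun j => complex.Im (h_ j x)).
  apply: cauchy_cvg; apply: cauchy_exP => e e0.
  have [N hN] := ch _ (divr_gt0 e0 (@ltr0Sn R 1)).
  exists (complex.Im (h_ N x)); exists N => // j /= Nj.
  rewrite /ball /= -ImN -ImD (le_lt_trans (ler_normIm _))//.
  by rewrite (le_lt_trans (hN N j (leqnn N) Nj x))// ltr_pdivrMr// ltr_pMr// ltr1n.
pose h x := limn (fun j => complex.Re (h_ j x)) +i* limn (fun j => complex.Im (h_ j x)).
have uni (e : R) : 0 < e -> \forall j \near \oo, forall x, Normc.normc (h_ j x - h x) <= e.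
  move=> e0; have [N hN] := ch _ e0; exists N => // j /= Nj x.
  apply/ler_addgt0Pr => d d0.
  have d20 : 0 < d / 2 by rewrite divr_gt0.
  have /cvgrPdist_le/(_ _ d20)[N1 _ h1] := cRe x.
  have /cvgrPdist_le/(_ _ d20)[N2 _ h2] := cIm x.
  pose i := maxn N (maxn N1 N2).
  have Ni : (N <= i)%N by exact: leq_maxl.
  have N1i : (N1 <= i)%N by rewrite !leq_max leqnn orbT.
  have N2i : (N2 <= i)%N by rewrite !leq_max leqnn !orbT.
  apply: (le_trans (normc_triangle (h_ i x) _ _)); rewrite lerD ?hN//.
  rewrite normcB (le_trans (normc_le_ReIm _))// (splitr d) lerD// ?ReD ?ImD ?ReN ?ImN.
    exact: h1.
  exact: h2.
exists h => //; split.
  apply/continuous_normcP => x e e0.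
  have e30 : 0 < e / 3 by rewrite divr_gt0.
  have [N _ hN] := uni _ e30; have [/continuous_normcP cN _] := bh_ N.
  move: (cN x _ e30); apply: filterS => y hy.
  apply: (le_lt_trans (normc_triangle (h_ N x) _ _)).
  have -> : e = e / 3 + (e / 3 + e / 3) by field.
  apply: ler_ltD; first by rewrite normcB; exact: (hN N (leqnn N)).
  apply: (le_lt_trans (normc_triangle (h_ N y) _ _)).
  by apply: ltr_leD => //; exact: (hN N (leqnn N)).
have [N _ hN] := uni _ ltr01; have [_ [M hM]] := bh_ N.
exists (1 + M) => x; rewrite -[h x](subrK (h_ N x)) (le_trans (normcD _ _))// lerD//.
by rewrite normcB; exact: (hN N (leqnn N)).
Qed.

Lemma Minf1_distE n (h h' : 'rV[R]_n -> R[i]) :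
  Minf1_dist hbar (window n) h h' = gnorm (fun x => h x - h' x).
Proof. by []. Qed.

Lemma Minf1_dist_normc n (h h' : 'rV[R]_n -> R[i]) x : bcontinuous h -> bcontinuous h' ->
  ((Normc.normc (h x - h' x))%:E <= Minf1_dist hbar (window n) h h')%E.
Proof.
move=> bh bh'.
exact: (normc_le_gnorm hbar_gt0 q_gt0 (h := fun x => h x - h' x) x (bcontinuousB bh bh')).
Qed.

Lemma Minf1_complete n (h_ : nat -> 'rV[R]_n -> R[i]) :
  Minf1_cauchy hbar (window n) h_ -> exists h, Minf1_lim hbar (window n) h_ h.
Proof.
move=> [mh_ ch].
have bh_ j : bcontinuous (h_ j) by have /Minf1_funP[] := mh_ j.
have [h bh uni] : exists2 h, bcontinuous h &
    forall e : R, 0 < e -> \forall j \near \oo, forall x, Normc.normc (h_ j x - h x) <= e.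
  apply: uniform_cauchy_limit => // e e0; have [N hN] := ch e e0.
  exists N => i j Ni Nj x; rewrite -lee_fin; apply/ltW.
  by apply: le_lt_trans (hN i j Ni Nj); exact: Minf1_dist_normc.
have dist0 (e : R) : 0 < e -> exists N, forall j, (N <= j)%N ->
    (gnorm (fun x => h_ j x - h x)%R <= e%:E)%E.
  move=> e0; have [N hN] := ch e e0; exists N => j Nj.
  (* With j fixed, the second index goes to infinity; shifting it by N makes the Cauchy bound hold
     for every i. *)
  apply: (@gnorm_le_uniform_limit n (fun i x => h_ j x - h_ (i + N)%N x)).
  - by move=> i; exact: bcontinuousB.
  - exact: bcontinuousB.
  - move=> d d0; have [N' _ hN'] := uni d d0; exists N' => // i /= N'i x.
    rewrite [X in Normc.normc X](_ : _ = h x - h_ (i + N)%N x); last by ring.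
    rewrite normcB.
    by apply: hN'; rewrite /= (leq_trans N'i)// leq_addr.
  - by move=> i; apply/ltW/hN => //; exact: leq_addl.
exists h; split => //.
  apply/Minf1_funP; split => //; have [N hN] := dist0 1 ltr01.
  have /Minf1_funP[_ hfin] := mh_ N.
  (* The limit inherits a finite norm from one term of the sequence at distance at most 1. *)
  rewrite (_ : h = (fun x => h_ N x - (h_ N x - h x))); last first.
    by apply/funext => x; rewrite subKr.
  apply: (le_lt_trans (gnormB_le (bh_ N) (bcontinuousB (bh_ N) bh))).
  apply: lte_add_pinfty; first exact: hfin.
  exact: le_lt_trans (hN N (leqnn N)) (ltry _).
rewrite (_ : (fun j => Minf1_dist hbar (window n) (h_ j) h) =
  (fun j => gnorm (fun x => h_ j x - h x)%R)); last first.
  by apply/funext => j; rewrite Minf1_distE.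
apply: near_ecvg0; first by move=> j; exact: gnorm_ge0.
by move=> e e0; have [N hN] := dist0 e e0; exists N; [exact: Logic.I|exact: hN].
Qed.

Lemma Minf1_lim_pointwise n (h_ : nat -> 'rV[R]_n -> R[i]) h x :
  Minf1_lim hbar (window n) h_ h ->
  forall e : R, 0 < e -> \forall j \near \oo, Normc.normc (h_ j x - h x) < e.
Proof.
move=> [mh_ mh ch] e e0; move: (ecvg0_near ch e0); apply: filterS => j hj.
rewrite -lte_fin; apply: le_lt_trans hj; apply: Minf1_dist_normc.
  by have /Minf1_funP[] := mh_ j.
by have /Minf1_funP[] := mh.
Qed.

End completeness.

(** * Restrictions of cylinder functions *)

Section restrictions.
Context (R : realType) (hbar : R) (q : nat -> R).
Hypothesis hbar_gt0 : 0 < hbar.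
Hypothesis q_gt0 : forall j, 0 < q j.
Local Notation gnorm := (gnorm hbar q).
Local Notation window n := (@gauss_window R hbar q n).

Lemma extend0E k (x : 'rV[R]_k) i (ik : (i < k)%N) : extend0 x i = x 0 (Ordinal ik).
Proof. by rewrite /extend0 insubT. Qed.

Lemma extend0_out k (x : 'rV[R]_k) i : (k <= i)%N -> extend0 x i = 0.
Proof. by move=> ki; rewrite /extend0 insubF// ltnNge ki. Qed.

Lemma extend0_snoc k (x : 'rV[R]_k) : extend0 (snoc_rV (x, 0)) = extend0 x.
Proof.
apply/funext => i; have [ik|ki|->] := ltngtP i k.
- rewrite (extend0E _ ik) (extend0E _ (leqW ik)) -(snoc_rV_lift x 0); congr (_ _ _).
  by apply/val_inj; rewrite /= /bump leqNgt ik add0n.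
- by rewrite !extend0_out// ltnW.
- rewrite [RHS]extend0_out// (extend0E _ (ltnSn k)) -[RHS](snoc_rV_max x 0).
  by congr (_ _ _); exact/val_inj.
Qed.

Lemma proj_extend0 m (x : 'rV[R]_m) : proj_rV m (extend0 x) = x.
Proof.
apply/rowP => i; rewrite mxE (extend0E _ (ltn_ord i)); congr (_ _ _).
exact/val_inj.
Qed.

Lemma proj_extend0_init m k (x : 'rV[R]_k.+1) : (m <= k)%N ->
  proj_rV m (extend0 x) = proj_rV m (extend0 (init_rV x)).
Proof.
move=> mk; apply/rowP => i; have ik := leq_trans (ltn_ord i) mk.
rewrite !mxE (extend0E _ ik) (extend0E _ (leqW ik)) mxE; congr (_ _ _).
by apply/val_inj; rewrite /= /bump leqNgt ik add0n.
Qed.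

(** Start at k = m, where the restriction is h itself, and move k by one. Going up adds a coordinate
    on which nothing depends, going down freezes the last coordinate at 0; neither step increases
    the norm. *)
Lemma restriction_cylinder_le m k (h : 'rV[R]_m -> R[i]) : bcontinuous h ->
  bcontinuous (restriction (k := k) (cylinder h)) /\
  (gnorm (restriction (k := k) (cylinder h)) <= gnorm h)%E.
Proof.
move=> bh; pose P k := bcontinuous (restriction (k := k) (cylinder h)) /\
  (gnorm (restriction (k := k) (cylinder h)) <= gnorm h)%E.
have Pm : P m.
  suff E : restriction (k := m) (cylinder h) = h by rewrite /P E; split.
  by apply/funext => x; rewrite /restriction /cylinder proj_extend0.
have up k' : (m <= k')%N -> P k' -> P k'.+1.
  move=> mk [b l].
  have E : restriction (k := k'.+1) (cylinder h) = lift_rV (restriction (k := k') (cylinder h)).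
    by apply/funext => x; rewrite /lift_rV /= /restriction /cylinder proj_extend0_init.
  rewrite /P E; split; first exact: bcontinuous_lift.
  by apply: le_trans l; exact: gnorm_lift_le.
have down k' : P k'.+1 -> P k'.
  move=> [b l].
  have E : restriction (k := k') (cylinder h) = slice (restriction (k := k'.+1) (cylinder h)) 0.
    by apply/funext => x; rewrite /slice /restriction extend0_snoc.
  rewrite /P E; split; first exact: bcontinuous_slice.
  by apply: le_trans l; exact: gnorm_slice_le.
suff : P k by [].
have [mk|/ltnW km] := leqP m k.
  rewrite -(subnK mk); elim: (k - m)%N => [|d IH]; first by rewrite add0n.
  by rewrite addSn; apply: up => //; exact: leq_addl.
move: Pm; rewrite -(subnK km); elim: (m - k)%N => [|d IH]; first by rewrite add0n.
by rewrite addSn => /down.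
Qed.

Lemma Minf1_fun_restriction F k : C0 hbar q F -> Minf1_fun hbar (window k) (restriction F).
Proof.
move=> [m [h /(Minf1_funP hbar q)[bh hfin] ->]].
have [b l] := restriction_cylinder_le k bh.
by apply/Minf1_funP => //; split => //; exact: le_lt_trans l hfin.
Qed.

(* A finite C0_norm is attained by a representation, since C0_norm is +oo by
   convention otherwise. *)
Lemma Minf1_dist_restriction F F' k (e : R) : (C0_dist hbar q F F' < e%:E)%E ->
  (Minf1_dist hbar (window k) (restriction F) (restriction F') < e%:E)%E.
Proof.
rewrite /C0_dist /C0_norm; case: xgetP => [r _ [m [h [mh FE ->]]]|_]; last first.
  by rewrite ltNge leey.
have [bh _] := (Minf1_funP hbar q h).1 mh.
have [_ l] := restriction_cylinder_le k bh.
apply: le_lt_trans; rewrite Minf1_distE.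
rewrite (_ : (fun x => _) = restriction (k := k) (cylinder h)); first exact: l.
by rewrite -FE.
Qed.

Lemma Minf1_cauchy_restriction f k : C0_cauchy hbar q f ->
  Minf1_cauchy hbar (window k) (fun n => restriction (f n)).
Proof.
move=> [f0 cf]; split; first by move=> j; exact: Minf1_fun_restriction.
move=> e e0; have [N hN] := cf e e0; exists N => i j Ni Nj.
by apply: Minf1_dist_restriction; exact: hN.
Qed.

End restrictions.

Theorem theorem5p5 (R : realType) (hbar : R) (q : nat -> R)
    (hbar_gt0 : 0 < hbar) (hbar_le1 : hbar <= 1)
    (q_gt0 : forall j, 0 < q j)
    (q_sqr_summable : cvgn (series (fun j => q j ^+ 2)))
    (f : nat -> (nat -> R) -> R[i]) (f_cauchy : C0_cauchy hbar q f) (k : nat) :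
  Minf1_cauchy hbar (@gauss_window R hbar q k) (fun n => restriction (f n)) /\
  exists fk : 'rV[R]_k -> R[i],
    unique (Minf1_lim hbar (@gauss_window R hbar q k)
              (fun n => restriction (f n))) fk /\
    forall f', C0_class hbar q f f' ->
      Minf1_lim hbar (@gauss_window R hbar q k)
        (fun n => restriction (f' n)) fk.
Proof.
have cf := Minf1_cauchy_restriction hbar_gt0 q_gt0 k f_cauchy.
split => //; have [fk lim_fk] := Minf1_complete hbar_gt0 q_gt0 cf.
(* Stated for a second sequence that is pointwise close to f, so that it serves twice: with f' = f
   for uniqueness of the limit, and with an equivalent f' for independence of the representative. *)
have lim_unique (f' : nat -> (nat -> R) -> R[i]) (g : 'rV[R]_k -> R[i]) :
    (forall (x : 'rV[R]_k) (e : R), 0 < e -> \forall j \near \oo,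
       Normc.normc (restriction (f j) x - restriction (f' j) x) < e) ->
    Minf1_lim hbar (@gauss_window R hbar q k) (fun n => restriction (f' n)) g -> fk = g.
  move=> close lim_g; apply/funext => x; apply/eqP; rewrite -subr_eq0.
  apply/eqP/normc_eq0/eqP; rewrite eq_le normc_ge0 andbT.
  apply/ler_addgt0Pr => e e0; rewrite add0r.
  have e30 : 0 < e / 3 by rewrite divr_gt0.
  have [j [h1 h2 h3]] : exists j, [/\ Normc.normc (restriction (f j) x - fk x) < e / 3,
      Normc.normc (restriction (f' j) x - g x) < e / 3 &
      Normc.normc (restriction (f j) x - restriction (f' j) x) < e / 3].
    near \oo => j; exists j; split; near: j.
    - exact: (Minf1_lim_pointwise hbar_gt0 q_gt0 x lim_fk e30).
    - exact: (Minf1_lim_pointwise hbar_gt0 q_gt0 x lim_g e30).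
    - exact: (close x _ e30).
  apply: (le_trans (normc_triangle (restriction (f j) x) _ _)).
  have -> : e = e / 3 + (e / 3 + e / 3) by field.
  apply: lerD; first by rewrite normcB ltW.
  apply: (le_trans (normc_triangle (restriction (f' j) x) _ _)).
  by apply: lerD; exact: ltW.
have bc (f' : nat -> (nat -> R) -> R[i]) j : C0_cauchy hbar q f' ->
    bcontinuous (restriction (k := k) (f' j)).
  move=> [f'0 _].
  exact: (((Minf1_funP hbar q _).1 (Minf1_fun_restriction hbar_gt0 q_gt0 k (f'0 j))).1).
exists fk; split.
  split => // g; apply: lim_unique => x e e0; apply: nearW => j.
  by rewrite subrr Normc.normc0.
move=> f' [cf' eqf].
(* The other representative has a limit of its own, by completeness; the two limits are then
   identified, since equivalence bounds the pointwise distance of the restrictions. *)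
have [g lim_g] := Minf1_complete hbar_gt0 q_gt0 (Minf1_cauchy_restriction hbar_gt0 q_gt0 k cf').
rewrite (lim_unique f' g)// => x e e0.
move: (ecvg0_near eqf e0); apply: filterS => j hj.
rewrite -lte_fin; apply: le_lt_trans (Minf1_dist_restriction hbar_gt0 q_gt0 k hj).
exact: (Minf1_dist_normc hbar_gt0 q_gt0 x (bc f j f_cauchy) (bc f' j cf')).
Unshelve. all: by end_near. Qed.
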